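(* Let $H\colon X_S\to D_\epsilon$ be the model neighborhood associated to a smooth function $S$, with singular point $s$, singular fiber $F_s$ and Lagrangian section $\sigma_S$. The symplectic group structure (fiberwise addition with respect to $\sigma_S$ on the fibers of $X_S\setminus F_s\to D_\epsilon\setminus\{0\}$) extends to a smooth map $$\bigl(X_S\times_{D_\epsilon}X_S\bigr)\setminus\{(s,s)\}\to X_S$$ over the projection to $D_\epsilon$.
   Context: Model neighborhood. Let $\mathbb{C}^2$ have coordinates $p=p_1+ip_2$, $q=q_1+iq_2$ and symplectic form $\omega_0=dp_1\wedge dq_1+dp_2\wedge dq_2$, and let $H(p,q)=-\bar p q=H_1+iH_2$. The Hamiltonian flows are $\phi_{H_1}^t(p,q)=(e^tp,e^{-t}q)$ and $\phi_{H_2}^t(p,q)=(e^{it}p,e^{it}q)$. Let $S$ be a smooth real-valued function on a disc around $0\in\mathbb{C}=\mathbb{R}^2$, with partial derivatives $S_1=\partial_1S$, $S_2=\partial_2S$. Let $\epsilon,\delta>0$ be sufficiently small constants, let $D_\epsilon\subset\mathbb{C}$ be the open disc of radius $\epsilon$ about $0$, and put $$X=\{(p,q)\in\mathbb{C}^2: |pq|<\epsilon\},\qquad X'=\{(p,q)\in X: |q|\le 1,\ |p|<e^{S_1(-\bar pq)+\delta}\}.$$ For $b\in D_\epsilon$ set $\sigma_1(b)=(e^{S_1(b)+iS_2(b)},-e^{-S_1(b)+iS_2(b)}b)$ and $\sigma_2(b)=(-\bar b,1)$ (Lagrangian sections of $H$). Then $X_S=X'/\sim$, where $\phi_{H_1}^{t_1}\phi_{H_2}^{t_2}(\sigma_1(b))\sim\phi_{H_1}^{t_1}\phi_{H_2}^{t_2}(\sigma_2(b))$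 for all $(t_1,t_2)\in[0,\delta)\times[0,2\pi)$ and $|b|<\epsilon$. The space $X_S$ is a smooth symplectic 4-manifold, with charts given by the restrictions of the quotient map to $\{(p,q)\in X:|q|<1,\ |p|<e^{S_1(-\bar pq)}\}$ and $\{(p,q)\in X: e^{S_1(-\bar pq)-\delta}<|p|<e^{S_1(-\bar pq)+\delta}\}$, which are diffeomorphisms onto open subsets. The symplectic form and $H$ descend to $X_S$, and $\sigma_1,\sigma_2$ descend to one Lagrangian section $\sigma_S\colon D_\epsilon\to X_S$. The point $s$ is the image of $(0,0)$, and $F_s=H^{-1}(0)$. Symplectic group structure. For $x,y$ in the same fiber over $b\ne0$, with $x=\phi_H^t(\sigma_S(b))$ and $y=\phi_H^{t'}(\sigma_S(b))$, where $\phi_H^{(t_1,t_2)}=\phi_{H_1}^{t_1}\circ\phi_{H_2}^{t_2}$ is the joint Hamiltonian flow on $X_S$, set $x+y=\phi_H^{t+t'}(\sigma_S(b))$. *)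

(* Defs.v *)
From mathcomp Require Import all_boot all_order all_algebra.
From mathcomp Require Import all_classical all_reals all_analysis.
From mathcomp Require Import complex.
From Stdlib Require Import Relation_Operators.

Set Implicit Arguments.
Unset Strict Implicit.
Unset Printing Implicit Defensive.

Import Order.TTheory GRing.Theory Num.Theory.
Import numFieldNormedType.Exports.
Import ComplexField.Normc.

Local Open Scope classical_set_scope.
Local Open Scope ring_scope.
Local Open Scope complex_scope.

Section Smooth.
Context {R : realType} {V W : normedModType R}.

(** [f] is [C^k] on the open set [U]. The differential at [x] is evaluated on a
    fixed vector [v], so that the induction stays inside functions [V -> W]; for
    the finite-dimensional [V] used below this is the usual notion. *)
Fixpoint Ck (k : nat) (U : set V) (f : V -> W) : Prop :=
  match k with
  | 0 => forall x, U x -> {for x, continuous f}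
  | k'.+1 => (forall x, U x -> differentiable f x) /\
             (forall v : V, Ck k' U (fun x => 'd f x v))
  end.

Definition smooth_on (U : set V) (f : V -> W) : Prop := forall k, Ck k U f.

End Smooth.

Section Coordinates.
Context {R : realType}.

Definition disc (r : R) : set (R * R) := [set x | x.1 ^+ 2 + x.2 ^+ 2 < r ^+ 2].

(** [R[i]] carries no real normed-module structure in the library, so calculus
    on [C^2] is done in the real coordinates [((p1, p2), (q1, q2))]. *)
Notation R4 := ((R * R) * (R * R))%type.

Definition toC2 (z : R4) : R[i] * R[i] := (z.1.1 +i* z.1.2, z.2.1 +i* z.2.2).

(** [omega0 = dp1 /\ dq1 + dp2 /\ dq2] *)
Definition omega0 (v w : R4) : R :=
  (v.1.1 * w.2.1 - v.2.1 * w.1.1) + (v.1.2 * w.2.2 - v.2.2 * w.1.2).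

Definition Hmod (z : R[i] * R[i]) : R[i] := - (conjc z.1 * z.2).
Definition H1 (z : R4) : R := complex.Re (Hmod (toC2 z)).
Definition H2 (z : R4) : R := complex.Im (Hmod (toC2 z)).

(** [v] is the value at [z] of the Hamiltonian vector field of [f]. The sign
    [omega0 (X_f, -) = - df] is the one for which [H1] and [H2] have the flows
    [phi1] and [phi2] below. *)
Definition hamiltonian_vector (f : R4 -> R) (z v : R4) : Prop :=
  forall w, omega0 v w = - 'd f z w.

Definition cexpi (t : R) : R[i] := cos t +i* sin t.

Definition phi1 (t : R) (z : R[i] * R[i]) : R[i] * R[i] :=
  ((expR t)%:C * z.1, (expR (- t))%:C * z.2).
Definition phi2 (t : R) (z : R[i] * R[i]) : R[i] * R[i] :=
  (cexpi t * z.1, cexpi t * z.2).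

End Coordinates.

Section ModelNeighborhood.
Context {R : realType}.
Context (S : R * R -> R) (eps del : R).

Notation C := (R[i]).
Notation R4 := ((R * R) * (R * R))%type.

Definition S1 (b : C) : R := 'D_(1, 0) S (complex.Re b, complex.Im b).
Definition S2 (b : C) : R := 'D_(0, 1) S (complex.Re b, complex.Im b).

Definition X : set (C * C) := [set z | normc (z.1 * z.2) < eps].

Definition X' : set (C * C) :=
  [set z | [/\ X z, normc z.2 <= 1 & normc z.1 < expR (S1 (Hmod z) + del)]].

Definition sigma1 (b : C) : C * C :=
  ((expR (S1 b))%:C * cexpi (S2 b), - ((expR (- S1 b))%:C * cexpi (S2 b) * b)).
Definition sigma2 (b : C) : C * C := (- conjc b, 1).

Definition glue (z w : C * C) : Prop :=
  exists b t1 t2, [/\ normc b < eps, 0 <= t1 < del, 0 <= t2 < 2 * pi,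
    z = phi1 t1 (phi2 t2 (sigma1 b)) & w = phi1 t1 (phi2 t2 (sigma2 b))].

(** The quotient map; points of [X_S] are the equivalence classes in [X'] of the
    equivalence relation generated by [glue]. *)
Definition cls (z : C * C) : set (C * C) :=
  [set w | X' w /\ clos_refl_sym_trans (C * C) glue z w].

Definition XS : set (set (C * C)) := cls @` X'.

(** [Hmod] is constant on each class; [HS x] is its value there. *)
Definition HS (x : set (C * C)) : C := xget 0 (Hmod @` x).

(** This is also the class of [sigma1 b], by [glue] with [t1 = t2 = 0]. *)
Definition sigmaS (b : C) : set (C * C) := cls (sigma2 b).
Definition sing : set (C * C) := cls (0, 0).

(** The restrictions of [cls] to the two members of [charts] are the (inverse)
    charts defining the smooth symplectic structure of [X_S]. *)
Definition U1 : set (C * C) :=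
  [set z | [/\ X z, normc z.2 < 1 & normc z.1 < expR (S1 (Hmod z))]].
Definition U2 : set (C * C) :=
  [set z | [/\ X z, expR (S1 (Hmod z) - del) < normc z.1
                  & normc z.1 < expR (S1 (Hmod z) + del)]].
Definition charts : set (set (C * C)) := [set U1; U2].

(** Integral curves in [X_S] of the Hamiltonian vector field of the function
    which is given by [f] in each chart. *)
Definition integral_curve (f : R4 -> R) (gam : R -> set (C * C)) : Prop :=
  forall t : R, exists U (c : R -> R4), charts U /\
    \forall u \near t, [/\ U (toC2 (c u)), gam u = cls (toC2 (c u)) &
      exists2 v, is_derive u 1 c v & hamiltonian_vector f (c u) v].

Definition flow (f : R4 -> R) (t : R) (x y : set (C * C)) : Prop :=
  exists gam, [/\ integral_curve f gam, gam 0 = x & gam t = y].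

(** [joint_flow t x y] : [y] is the image of [x] under the time [t.1] flow of
    [H1] composed with the time [t.2] flow of [H2]. *)
Definition joint_flow (t : R * R) (x y : set (C * C)) : Prop :=
  exists2 w, flow H2 t.2 x w & flow H1 t.1 w y.

(** [z] is the sum of the points [x], [y] of the fiber over [b]. *)
Definition fiber_sum (b : C) (x y z : set (C * C)) : Prop :=
  exists t t' : R * R, [/\ joint_flow t (sigmaS b) x,
    joint_flow t' (sigmaS b) y & joint_flow (t + t') (sigmaS b) z].

Definition fiber_product : set (set (C * C) * set (C * C)) :=
  [set xy | [/\ XS xy.1, XS xy.2 & HS xy.1 = HS xy.2]].

Definition punctured_fiber_product : set (set (C * C) * set (C * C)) :=
  fiber_product `\ (sing, sing).

(** Away from [(sing, sing)] the fiber product is an embedded submanifold of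
    [X_S * X_S]; a map on it is smooth when, read in charts, it is locally the
    restriction of a smooth map defined on an open subset of the product. *)
Definition smooth_on_punctured_fiber_product
    (A : set (C * C) -> set (C * C) -> set (C * C)) : Prop :=
  forall x y, punctured_fiber_product (x, y) ->
  exists (U U' U'' : set (C * C)) (z z' : R4)
    (N : set (R4 * R4)) (F : R4 * R4 -> R4),
  [/\ charts U, charts U' & charts U''] /\
  [/\ U (toC2 z), U' (toC2 z'), x = cls (toC2 z) & y = cls (toC2 z')] /\
  [/\ open N, N (z, z'), smooth_on N F &
      forall w w', N (w, w') -> U (toC2 w) -> U' (toC2 w') ->
        punctured_fiber_product (cls (toC2 w), cls (toC2 w')) ->
        U'' (toC2 (F (w, w'))) /\
        A (cls (toC2 w)) (cls (toC2 w')) = cls (toC2 (F (w, w')))].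

End ModelNeighborhood.

(* Main.v *)
Require Import Defs.
From HB Require Import structures.
From mathcomp Require Import all_boot all_order all_algebra.
From mathcomp Require Import all_classical all_reals all_analysis.
From mathcomp Require Import complex ring lra.
From Stdlib Require Import Relation_Operators.

Set Implicit Arguments.
Unset Strict Implicit.
Unset Printing Implicit Defensive.

Import Order.TTheory GRing.Theory Num.Theory.
Import numFieldNormedType.Exports.
Import ComplexField.Normc.

Local Open Scope classical_set_scope.
Local Open Scope ring_scope.
Local Open Scope complex_scope.

(** Write [H = b]. On the part [b <> 0] the joint flow acts on a fiber of [X_S] by
    [(p, q) |-> (e^t p, e^(- conj t) q)], with [t = t1 + i t2]. Starting from
    [sigma2 b = (- conj b, 1)], the point reached at time [t] has
    [e^t = 1 / conj q = - p / conj b]. This complex number is the _multiplier_ of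
    the point. Gluing [sigma1] to [sigma2] identifies multipliers that differ by
    a power of the _period_ [e^(S1 + i S2) / (- conj b)], so that the fiber is the
    torus [C^* / period^Z], and the addition of points is the multiplication of
    multipliers. On the singular fiber [b = 0] the gluing attaches the end of the
    [p]-axis to the end of the [q]-axis. The smooth points then form one copy of
    [C^*], with multiplier [1 / conj q] on the [q]-axis and [p / e^(S1 + i S2)] on
    the [p]-axis, and the singular point has multiplier [0]. With the period put
    equal to [1] over [b = 0], one definition of the multiplier serves for all
    fibers ([multiplier], [period]).

    The set [|q| < 1, |p| <= e^S1] meets every class exactly once ([X'_fundom],
    [fundom_inj]): over [b <> 0] it is the annulus of multipliers with norm in
    ]1, |period|]. Hence two points of [X'] are identified exactly when they have
    the same value of [H] and the same multiplier modulo the period ([clsE]).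

    Multiplication of multipliers is given by two explicit formulas,
      [(p, q) + (p', q') = (p / conj q', q q')], for [q' <> 0], and
      [(p, q) + (p', q') = (p p' / e^w, q' e^(conj w) / conj p)], for [p <> 0],
    with [w = S1 + i S2] ([add_qP], [add_pP]). Neither divides by [b], so both make
    sense, and are smooth, across [b = 0]. For two points of the fundamental
    domain, not both equal to [(0, 0)], one of these formulas or of those with the
    summands exchanged gives a point of the fundamental domain again
    ([fundom_sum_formula]): the first one when [|p| <= e^S1 |q'|], the second one
    otherwise. This covers exactly the complement of the pair of singular
    points and proves smoothness ([smooth_fiber_add]).

    It remains to compare with the sum defined through the flows. In a chart an
    integral curve solves a linear equation, so that locally its multiplier is
    that of the linear flow. Since being on the expected point of the torus is a
    locally constant property of the time, it holds for all times
    ([flow_fiber_point_unique]). Conversely the points with multiplier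
    [e^(t k) a] form a complete integral curve ([flow_fiber_point_exists]). As the
    complex exponential is onto [C^*] ([polar]), the sum defined by flows is the
    product of the multipliers ([fiber_sum_fiber_add]). *)

(** * Smooth maps *)

Section SmoothCalculus.
Context {R : realType}.

(** Differentials only depend on germs; this makes [Ck_ext] below true on open
    sets. *)
Lemma near_eq_differentiable (V W : normedModType R) (f g : V -> W) (x : V) :
  {near x, f =1 g} -> differentiable f x -> differentiable g x.
Proof.
move=> fg df.
have fgx : f x = g x := nbhs_singleton fg.
have H : g \o shift x = cst (g x) + 'd f x +o_ 0 id.
  apply/eqaddoP => e e0.
  have := diff_locally df; move/eqaddoP/(_ e e0) => Hf.
  have Hn : \forall y \near 0, f (y + x) = g (y + x).
    have := fg; rewrite (near_shift 0 x) /=.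
    by apply: filterS => y /=; rewrite subr0 addrC.
  near=> y.
  have -> : (g \o shift x - (cst (g x) + 'd f x)) y =
            (f \o shift x - (cst (f x) + 'd f x)) y.
    rewrite !fctE /= fgx; congr (_ - _); rewrite -(near Hn y)//.
  by near: y.
apply/diff_locallyP.
have -> : 'd g x = 'd f x :> (V -> W).
  by apply: diff_unique => //; exact: diff_continuous.
by split => //; exact: diff_continuous.
Unshelve. all: by end_near. Qed.

Lemma near_eq_diff (V W : normedModType R) (f g : V -> W) (x v : V) :
  {near x, f =1 g} -> differentiable f x -> 'd g x v = 'd f x v.
Proof.
move=> fg df; have dg := near_eq_differentiable fg df.
rewrite -!deriveE//; apply: near_eq_derive.
by apply: filterS fg => y ->.
Qed.

(** This is how every closure property of [Ck] is proved: the differential of the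
    composite map agrees on [U], pointwise, with an expression to which the
    induction hypothesis applies. *)
Lemma Ck_ext (V W : normedModType R) (U : set V) k (f g : V -> W) :
  open U -> (forall x, U x -> f x = g x) -> Ck k U f -> Ck k U g.
Proof.
move=> oU; elim: k f g => [|k IH] f g fg /=.
  move=> cf x Ux; have nU := open_nbhs_nbhs (conj oU Ux).
  rewrite /prop_for /continuous_at -fg//; apply: cvg_trans (cf x Ux).
  by apply: near_eq_cvg; apply: filterS nU => y /fg.
have nfg x : U x -> {near x, f =1 g}.
  by move=> Ux; apply: filterS (open_nbhs_nbhs (conj oU Ux)) => y /fg.
move=> [df ddf]; split=> [x Ux|v].
  exact: near_eq_differentiable (nfg x Ux) (df x Ux).
refine (IH (fun x => 'd f x v) _ _ (ddf v)) => x Ux.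
by rewrite (near_eq_diff _ (nfg x Ux) (df x Ux)).
Qed.

Lemma CkW (V W : normedModType R) (U : set V) k (f : V -> W) :
  Ck k.+1 U f -> Ck k U f.
Proof.
elim: k f => [|k IH] f [df ddf].
  by move=> x Ux; apply: differentiable_continuous; apply: df.
by split=> [//|v]; apply: IH; exact: ddf.
Qed.

Lemma Ck_subset (V W : normedModType R) (U U' : set V) k (f : V -> W) :
  U' `<=` U -> Ck k U f -> Ck k U' f.
Proof.
move=> sU; elim: k f => [|k IH] f /=; first by move=> cf x /sU /cf.
by move=> [df ddf]; split=> [x /sU/df//|v]; apply: IH.
Qed.

Lemma Ck_continuous (V W : normedModType R) (U : set V) k (f : V -> W) x :
  Ck k U f -> U x -> {for x, continuous f}.
Proof.
case: k => [cf /cf//|k [df _] Ux].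
by apply: differentiable_continuous; exact: df.
Qed.

Lemma Ck_cst (V W : normedModType R) (U : set V) k (c : W) :
  Ck k U (fun _ : V => c).
Proof.
elim: k c => [|k IH] c /=; first by move=> x _; exact: cst_continuous.
split=> [x _|v]; first exact: differentiable_cst.
rewrite (_ : (fun x => _) = fun=> 0)//.
by apply/funext => x; rewrite (diff_cst c).
Qed.

Lemma Ck_linear (V W : normedModType R) (U : set V) k (f : {linear V -> W}) :
  continuous f -> Ck k U f.
Proof.
move=> cf; case: k => [|k] /=; first by move=> x _; exact: cf.
split=> [x _|v]; first exact: linear_differentiable.
rewrite (_ : (fun x => _) = fun=> f v); first exact: Ck_cst.
by apply/funext => x; rewrite diff_lin.
Qed.

Lemma Ck_id (V : normedModType R) (U : set V) k : Ck k U (fun x : V => x).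
Proof. by apply: (@Ck_linear _ _ _ _ idfun) => x; exact: cvg_id. Qed.

Lemma Ck_lincomp (V W Z : normedModType R) (U : set V) k (h : {linear W -> Z})
    (f : V -> W) : open U -> continuous h -> Ck k U f -> Ck k U (fun x => h (f x)).
Proof.
move=> oU ch; elim: k f => [|k IH] f /=.
  by move=> cf x /cf cfx; apply: (continuous_comp cfx); exact: ch.
move=> [df ddf]; split=> [x Ux|v].
  apply: differentiable_comp (df x Ux) _; exact: linear_differentiable.
apply: (Ck_ext oU _ (IH _ (ddf v))) => x Ux.
rewrite (diff_comp (df x Ux) (linear_differentiable _ ch)) /=.
by rewrite diff_lin.
Qed.

Lemma Ck_pair (V W Z : normedModType R) (U : set V) k (f : V -> W) (g : V -> Z) :
  open U -> Ck k U f -> Ck k U g -> Ck k U (fun x => (f x, g x)).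
Proof.
move=> oU; elim: k f g => [|k IH] f g /=.
  by move=> cf cg x Ux; apply: cvg_pair; [exact: cf|exact: cg].
move=> [df ddf] [dg ddg]; split=> [x Ux|v].
  by apply: differentiable_pair; [exact: df|exact: dg].
apply: (Ck_ext oU _ (IH _ _ (ddf v) (ddg v))) => x Ux.
by rewrite diff_pair//; [exact: df|exact: dg].
Qed.

Lemma diff_is_derive (V W : normedModType R) (f : V -> W) (x v : V) :
  differentiable f x -> is_derive x v f ('d f x v).
Proof.
move=> df; rewrite -(deriveE v df); apply: derivableP.
exact: diff_derivable.
Qed.

(** The calculus of directional derivatives computes differentials evaluated at a
    fixed vector, which is the form in which [Ck] uses them. *)
Lemma is_derive_diff (V W : normedModType R) (f : V -> W) (x v : V) (l : W) :
  differentiable f x -> is_derive x v f l -> 'd f x v = l.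
Proof. by move=> df fl; rewrite -(deriveE v df) (@derive_val _ _ _ _ _ _ _ fl). Qed.

Lemma Ck_add (V W : normedModType R) (U : set V) k (f g : V -> W) :
  open U -> Ck k U f -> Ck k U g -> Ck k U (fun x => f x + g x).
Proof.
move=> oU; elim: k f g => [|k IH] f g.
  by move=> cf cg x Ux; apply: cvgD; [exact: cf|exact: cg].
move=> [df ddf] [dg ddg].
have dfg x : U x -> differentiable (fun y => f y + g y) x.
  by move=> Ux; apply: differentiableD; [exact: df|exact: dg].
split=> [x Ux|v]; first exact: dfg.
apply: (Ck_ext oU _ (IH _ _ (ddf v) (ddg v))) => x Ux.
apply/esym/(is_derive_diff (dfg x Ux)).
by apply: is_deriveD; apply: diff_is_derive; [exact: df|exact: dg].
Qed.

Lemma Ck_mul (V : normedModType R) (U : set V) k (f g : V -> R) :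
  open U -> Ck k U f -> Ck k U g -> Ck k U (fun x => f x * g x).
Proof.
move=> oU; elim: k f g => [|k IH] f g.
  by move=> /= cf cg x Ux; apply: cvgM; [exact: cf|exact: cg].
move=> Cf Cg; have [df ddf] := Cf; have [dg ddg] := Cg.
have dfg x : U x -> differentiable (f * g) x.
  by move=> Ux; apply: differentiableM; [exact: df|exact: dg].
split=> [x Ux|v]; first exact: dfg.
apply: (Ck_ext oU _ (Ck_add oU (IH _ _ (CkW Cf) (ddg v)) (IH _ _ (CkW Cg) (ddf v)))).
move=> x Ux; apply/esym/(is_derive_diff (dfg x Ux)).
by apply: is_deriveM; apply: diff_is_derive; [exact: df|exact: dg].
Qed.

Lemma Ck_opp (V : normedModType R) (U : set V) k (f : V -> R) :
  open U -> Ck k U f -> Ck k U (fun x => - f x).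
Proof.
move=> oU Cf.
have C1 : Ck k U (fun _ : V => - 1 : R) by exact: Ck_cst.
apply: (Ck_ext oU _ (Ck_mul oU C1 Cf)) => x _.
by rewrite mulN1r.
Qed.

Lemma Ck_inv (V : normedModType R) (U : set V) k (f : V -> R) :
  open U -> (forall x, U x -> f x != 0) -> Ck k U f -> Ck k U (fun x => (f x)^-1).
Proof.
move=> oU f0; elim: k => [|k IH].
  by move=> /= cf x Ux; apply: cvgV; [exact: f0|exact: cf].
move=> Cf; have [df ddf] := Cf.
have dV x : U x -> differentiable (fun y => (f y)^-1) x.
  by move=> Ux; apply: differentiableV; [exact: df|exact: f0].
split=> [x Ux|v]; first exact: dV.
have Ci := IH (CkW Cf).
apply: (Ck_ext oU _ (Ck_mul oU (Ck_opp oU (Ck_mul oU Ci Ci)) (ddf v))) => x Ux.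
apply/esym/(is_derive_diff (dV x Ux)).
have fv := diff_derivable (v := v) (df x Ux).
split; first exact: derivableV (f0 x Ux) fv.
by rewrite (deriveV (f0 x Ux) fv) (deriveE v (df x Ux)) -invfM -expr2.
Qed.

(** One order of smoothness is gained over that of [g' \o f], since the
    differential of [g \o f] along [v] is ['d f x v * g' (f x)]. With [g'] again an
    elementary function, induction on the order applies. *)
Lemma Ck_comp1 (V : normedModType R) (U : set V) (k : nat) (f : V -> R) (g g' : R -> R) :
  open U -> (forall y : R, is_derive y (1 : R) g (g' y)) -> Ck k.+1 U f ->
  Ck k U (fun x => g' (f x)) -> Ck k.+1 U (fun x => g (f x)).
Proof.
move=> oU dg Cf Cg'.
have dgd (y : R) : differentiable g y.
  by apply/derivable1_diffP; case: (dg y).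
have dgf x : U x -> differentiable (fun y => g (f y)) x.
  by move=> Ux; apply: (differentiable_comp (Cf.1 x Ux)); exact: dgd.
split=> [x Ux|v]; first exact: dgf.
apply: (Ck_ext oU _ (Ck_mul oU (Cf.2 v) Cg')) => x Ux.
have E := congr1 (@^~ v) (diff_comp (Cf.1 x Ux) (dgd (f x))).
rewrite /= in E; rewrite [RHS]E.
have E2 := congr1 (@^~ ('d f x v)) (deriv1E (ex_derive (is_derive := dg (f x)))).
rewrite /= in E2; rewrite [RHS]E2.
by rewrite derive1E (@derive_val _ _ _ _ _ _ _ (dg (f x))).
Qed.

Lemma Ck_expR (V : normedModType R) (U : set V) (k : nat) (f : V -> R) :
  open U -> Ck k U f -> Ck k U (fun x => expR (f x)).
Proof.
move=> oU; elim: k => [|k IH] Cf.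
  by move=> x /Cf cfx; apply: (continuous_comp cfx); exact: continuous_expR.
exact: (Ck_comp1 oU (@is_derive_expR R) Cf (IH (CkW Cf))).
Qed.

Lemma Ck_cos_sin (V : normedModType R) (U : set V) (k : nat) (f : V -> R) :
  open U -> Ck k U f -> Ck k U (fun x => cos (f x)) /\ Ck k U (fun x => sin (f x)).
Proof.
move=> oU; elim: k => [|k IH] Cf.
  split=> x /Cf cfx; apply: (continuous_comp cfx).
    exact: continuous_cos.
  exact: continuous_sin.
have [Cc Cs] := IH (CkW Cf); split.
  exact: (Ck_comp1 oU (@is_derive_cos R) Cf (Ck_opp oU Cs)).
exact: (Ck_comp1 oU (@is_derive_sin R) Cf Cc).
Qed.

Lemma Ck_comp2 (V : normedModType R) (U : set V) (U' : set (R * R)) (k : nat)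
    (f1 f2 : V -> R) (g : R * R -> R) :
  open U -> open U' -> (forall x, U x -> U' (f1 x, f2 x)) ->
  Ck k U f1 -> Ck k U f2 -> Ck k U' g -> Ck k U (fun x => g (f1 x, f2 x)).
Proof.
move=> oU oU' UU'; elim: k g => [|k IH] g Cf1 Cf2 Cg.
  move=> x Ux; apply: (@continuous_comp _ _ _ (fun x => (f1 x, f2 x)) g).
    exact: (@Ck_pair _ _ _ _ 0 _ _ oU Cf1 Cf2).
  exact: Cg (UU' x Ux).
have df x : U x -> differentiable (fun x => (f1 x, f2 x)) x.
  by move=> Ux; apply: differentiable_pair; [exact: Cf1.1|exact: Cf2.1].
have dg x : U x -> differentiable g (f1 x, f2 x).
  by move=> Ux; exact: Cg.1 (UU' x Ux).
have dgf x : U x -> differentiable (fun y => g (f1 y, f2 y)) x.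
  by move=> Ux; apply: (differentiable_comp (df x Ux)); exact: dg.
split=> [x Ux|v]; first exact: dgf.
have Ci u := IH _ (CkW Cf1) (CkW Cf2) (Cg.2 u).
apply: (Ck_ext oU _ (Ck_add oU (Ck_mul oU (Cf1.2 v) (Ci (1, 0)))
                               (Ck_mul oU (Cf2.2 v) (Ci (0, 1))))) => x Ux.
have E := congr1 (@^~ v) (diff_comp (df x Ux) (dg x Ux)).
rewrite /= in E; rewrite [RHS]E.
have E2 := congr1 (@^~ v) (diff_pair (Cf1.1 x Ux) (Cf2.1 x Ux)).
rewrite /= in E2; rewrite E2.
set a := 'd f1 x v; set b := 'd f2 x v.
(* [g] is differentiated along fixed vectors only, so the moving direction
   [(a, b)] is expanded in the standard basis. *)
have -> : (a, b) = a *: ((1, 0) : R * R) + b *: ((0, 1) : R * R).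
  by congr pair; rewrite /= /GRing.scale /= mulr1 mulr0 ?addr0 ?add0r.
by rewrite linearD !linearZ.
Qed.

End SmoothCalculus.

(** * The complex exponential *)

(** Locked, so that the multiplicativity of the norm and of the conjugation does not
    rewrite inside an exponential. *)
HB.lock Definition cexp {R : realType} (t : R[i]) : R[i] :=
  (expR (complex.Re t))%:C * cexpi (complex.Im t).

Section ComplexExponential.
Context {R : realType}.
Implicit Types (t s z w : R[i]) (a b c d : R).

Lemma ReD z w : complex.Re (z + w) = complex.Re z + complex.Re w.
Proof. by case: z; case: w. Qed.
Lemma ImD z w : complex.Im (z + w) = complex.Im z + complex.Im w.
Proof. by case: z; case: w. Qed.
Lemma complex_mulE a b c d :
  (a +i* b) * (c +i* d) = (a * c - b * d) +i* (a * d + b * c) :> R[i].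
Proof. by []. Qed.
Lemma complex_ext z w : complex.Re z = complex.Re w ->
  complex.Im z = complex.Im w -> z = w.
Proof. by case: z; case: w => a b c d /= -> ->. Qed.

Lemma conjcM z w : conjc (z * w) = conjc z * conjc w.
Proof. exact: rmorphM. Qed.
Lemma conjcN z : conjc (- z) = - conjc z.
Proof. exact: rmorphN. Qed.

Lemma cexpiD a b : cexpi (a + b) = cexpi a * cexpi b.
Proof. by rewrite /cexpi complex_mulE cosD sinD; congr Complex; ring. Qed.

Lemma cexpE t : cexp t = (expR (complex.Re t))%:C * cexpi (complex.Im t).
Proof. by rewrite cexp.unlock. Qed.

Lemma cexpD t s : cexp (t + s) = cexp t * cexp s.
Proof. by rewrite !cexpE ReD ImD expRD cexpiD rmorphM mulrACA. Qed.

Lemma cexp0 : cexp (0 : R[i]) = 1.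
Proof. by rewrite cexpE /= expR0 /cexpi cos0 sin0 mulr1. Qed.

Lemma cexp_neq0 t : cexp t != 0.
Proof.
have H : cexp t * cexp (- t) = 1 by rewrite -cexpD subrr cexp0.
by apply/eqP => E; move: H; rewrite E mul0r => /eqP; rewrite eq_sym oner_eq0.
Qed.

Lemma cexpN t : cexp (- t) = (cexp t)^-1.
Proof. by apply: (mulfI (cexp_neq0 t)); rewrite -cexpD subrr cexp0 mulfV ?cexp_neq0. Qed.

Lemma normc_cexpi a : normc (cexpi a) = 1.
Proof. by rewrite /= cos2Dsin2 sqrtr1. Qed.

Lemma normc_real a : 0 <= a -> normc a%:C = a.
Proof. by move=> a0; rewrite /= expr0n /= addr0 sqrtr_sqr ger0_norm. Qed.

Lemma normc_cexp t : normc (cexp t) = expR (complex.Re t).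
Proof. by rewrite cexpE normcM normc_cexpi mulr1 normc_real// expR_ge0. Qed.

Lemma normc_conj z : normc (conjc z) = normc z.
Proof. by case: z => a b /=; rewrite sqrrN. Qed.

Lemma normc_ge0 z : 0 <= normc z.
Proof. by case: z => a b; exact: sqrtr_ge0. Qed.

Lemma normc_eq0 z : (normc z == 0) = (z == 0).
Proof. by apply/eqP/eqP => [/eq0_normc//|->]; rewrite normc0. Qed.

Lemma normc_gt0 z : (0 < normc z) = (z != 0).
Proof. by rewrite lt_neqAle normc_ge0 andbT eq_sym normc_eq0. Qed.

Lemma conjc_cexp t : conjc (cexp t) = cexp (conjc t).
Proof.
case: t => a b; rewrite !cexpE /cexpi /= cosN sinN !complex_mulE.
by apply: complex_ext => /=; ring.
Qed.

Lemma cexp_split a b : cexp (a +i* b) = (expR a)%:C * cexpi b.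
Proof. by rewrite cexpE. Qed.

Lemma cexpi_surj z : normc z = 1 -> exists2 a, 0 <= a < 2 * pi & cexpi a = z.
Proof.
case: z => x y /= /(congr1 (fun r => r ^+ 2)).
rewrite sqr_sqrtr ?expr1n; last by rewrite addr_ge0 ?sqr_ge0.
move=> xy.
have x1 : -1 <= x <= 1.
  by rewrite -ler_norml -sqrtr_sqr -[leRHS]sqrtr1 ler_sqrt// -xy lerDl sqr_ge0.
have yE : 1 - x ^+ 2 = y ^+ 2 by rewrite -xy addrC addKr.
have pi0 := @pi_gt0 R.
(* [acos x] is the angle in the closed upper half-plane, [2 pi - acos x] in the
   open lower one. *)
have [y0|y0] := leP 0 y.
  exists (acos x); last first.
    by rewrite /cexpi acosK ?in_itv//= sin_acos// yE sqrtr_sqr ger0_norm.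
  rewrite acos_ge0//=; apply: (le_lt_trans (acos_lepi x1)).
  by rewrite mulrC mulr_natr mulr2n ltrDl.
have x1' : -1 <= x < 1.
  case/andP: x1 => -> /=; rewrite le_eqVlt => /predU1P[xE|//].
  by move: yE; rewrite xE expr1n subrr => /esym/eqP; rewrite sqrf_eq0 (lt_eqF y0).
exists (- acos x + pi *+ 2); last first.
  rewrite /cexpi cosD2pi sinD2pi cosN sinN acosK ?in_itv//= sin_acos//.
  by rewrite yE sqrtr_sqr ltr0_norm// opprK.
have := acos_lepi x1; have := acos_gt0 x1'; rewrite mulr2n => ? ?.
by apply/andP; split; lra.
Qed.

Lemma polar z : z != 0 ->
  exists t, [/\ cexp t = z, expR (complex.Re t) = normc z & 0 <= complex.Im t < 2 * pi].
Proof.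
move=> z0; have nz : 0 < normc z by rewrite normc_gt0.
have nzC : (normc z)%:C != 0 :> R[i].
  by rewrite eq_complex /= negb_and (gt_eqF nz).
have [|b b2 bE] := @cexpi_surj (z / (normc z)%:C).
  by rewrite normcM normcV normc_real ?normc_ge0// divff// gt_eqF.
exists (ln (normc z) +i* b); split=> //=; last by rewrite lnK.
by rewrite cexp_split lnK// bE mulrC divfK.
Qed.

End ComplexExponential.

(** * Curves and linear differential equations in the complex plane *)

Section ComplexCurves.
Context {R : realType}.
Notation C := (R[i]).
Notation R4 := ((R * R) * (R * R))%type.

(** The mean value theorem on the segments that join [t] to the points of a ball. *)
Lemma near0_derive_cst (f : R -> R) (t : R) :
  (\forall u \near t, is_derive u (1 : R) f 0) -> \forall u \near t, f u = f t.
Proof.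
move=> /nbhs_ballP[e e0 H].
have key a b : a <= b -> ball t e a -> ball t e b -> f a = f b.
  move=> ab ta tb.
  have inb x : a <= x <= b -> ball t e x.
    move=> /andP[ax xb]; move: ta tb; rewrite /ball /= !ltr_distlC => /andP[h1 h2] /andP[h3 h4].
    by apply/andP; split; lra.
  have [||c _ /eqP] := @MVT_segment R f (fun=> 0) a b ab.
  - by move=> x; rewrite in_itv /= => /andP[ax xb]; apply: H; apply: inb; rewrite !ltW.
  - apply: continuous_in_subspaceT => x; rewrite inE /= in_itv /= => xab.
    have Hx := H _ (inb x xab).
    by apply/differentiable_continuous/derivable1_diffP; case: Hx.
  - by rewrite mul0r subr_eq0 => /eqP.
apply/nbhs_ballP; exists e => // u tu.
have tt : ball t e t by exact: ballxx.
by case: (leP u t) => [ut|/ltW tu']; [apply: key|apply/esym/key].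
Qed.

(** The set where [G] holds is open and closed, and the line is connected. *)
Lemma locally_constant_prop (G : R -> Prop) :
  (forall t, \forall u \near t, G u <-> G t) -> G 0 -> forall t, G t.
Proof.
move=> H G0.
have itv : is_interval (@setT R) by [].
have /connected_intervalP cT := itv.
suff -> : G = setT by [].
apply: cT; first by exists 0.
- exists G; last by rewrite setTI.
  by rewrite openE => t Gt; apply: filterS (H t) => u [_]; apply.
- exists G; last by rewrite setTI.
  rewrite -openC openE => t nGt.
  by apply: filterS (H t) => u [uG _] /uG.
Qed.

Definition cderiv (w : R -> C) (u : R) (l : C) : Prop :=
  is_derive u (1 : R) (fun s => complex.Re (w s)) (complex.Re l) /\
  is_derive u (1 : R) (fun s => complex.Im (w s)) (complex.Im l).

Lemma cderiv_cst (z : C) u : cderiv (fun=> z) u 0.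
Proof. by split; exact: is_derive_cst. Qed.

Lemma is_derive1_mul (f g : R -> R) (u a b : R) :
  is_derive u (1 : R) f a -> is_derive u (1 : R) g b ->
  is_derive u (1 : R) (fun s => f s * g s) (f u * b + g u * a).
Proof. by move=> df dg; exact: is_deriveM. Qed.

Lemma is_derive1_sub (f g : R -> R) (u a b : R) :
  is_derive u (1 : R) f a -> is_derive u (1 : R) g b ->
  is_derive u (1 : R) (fun s => f s - g s) (a - b).
Proof. by move=> df dg; exact: is_deriveB. Qed.

Lemma cderiv_cexp (w : R -> C) (u t : R) (k l : C) : cderiv w u l ->
  cderiv (fun s => cexp ((s - t)%:C * k) * w s) u
         (cexp ((u - t)%:C * k) * (k * w u + l)).
Proof.
case: k l => a b [l1 l2] [/= d1 d2].
have E (s : R) : cexp ((s - t)%:C * (a +i* b)) =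
    (expR ((s - t) * a) * cos ((s - t) * b)) +i*
    (expR ((s - t) * a) * sin ((s - t) * b)).
  rewrite cexpE /cexpi !complex_mulE /= !mul0r ?subr0 ?addr0.
  by congr Complex; ring.
have dl (c : R) : is_derive u (1 : R) (fun s => (s - t) * c) c.
  have dst : is_derive u (1 : R) (fun s : R => s - t) (1 - 0).
    exact: is_derive1_sub.
  have := is_derive1_mul dst (is_derive_cst c u (1 : R)).
  by rewrite /= mulr0 add0r subr0 mulr1.
have de : is_derive u (1 : R) (fun s => expR ((s - t) * a)) (expR ((u - t) * a) * a).
  exact: (is_derive1_comp (is_derive_expR _) (dl a)).
have dc : is_derive u (1 : R) (fun s => cos ((s - t) * b)) (- sin ((u - t) * b) * b).
  exact: (is_derive1_comp (is_derive_cos _) (dl b)).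
have ds : is_derive u (1 : R) (fun s => sin ((s - t) * b)) (cos ((u - t) * b) * b).
  exact: (is_derive1_comp (is_derive_sin _) (dl b)).
split.
- have -> : (fun s => complex.Re (cexp ((s - t)%:C * (a +i* b)) * w s)) =
    (fun s => expR ((s - t) * a) * cos ((s - t) * b) * complex.Re (w s) -
              expR ((s - t) * a) * sin ((s - t) * b) * complex.Im (w s)).
    by apply/funext => s; rewrite E; case: (w s).
  rewrite E; apply: is_derive_eq; case: (w u) => x y.
  by rewrite /GRing.scale /=; ring.
- have -> : (fun s => complex.Im (cexp ((s - t)%:C * (a +i* b)) * w s)) =
    (fun s => expR ((s - t) * a) * cos ((s - t) * b) * complex.Im (w s) +
              expR ((s - t) * a) * sin ((s - t) * b) * complex.Re (w s)).
    by apply/funext => s; rewrite E; case: (w s).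
  rewrite E; apply: is_derive_eq; case: (w u) => x y.
  by rewrite /GRing.scale /=; ring.
Qed.

(** The product of [w] with the inverse of the expected exponential has derivative
    zero. *)
Lemma cderiv_linear_ODE (w : R -> C) (t : R) (k : C) :
  (\forall u \near t, cderiv w u (k * w u)) ->
  \forall u \near t, w u = cexp ((u - t)%:C * k) * w t.
Proof.
move=> H.
have H0 : \forall u \near t, cderiv (fun s => cexp ((s - t)%:C * - k) * w s) u 0.
  apply: filterS H => u /(cderiv_cexp t (- k)).
  by rewrite mulNr addNr mulr0.
have H1 : \forall u \near t, complex.Re (cexp ((u - t)%:C * - k) * w u) = complex.Re (w t).
  have := @near0_derive_cst (fun s => complex.Re (cexp ((s - t)%:C * - k) * w s)) t.
  by rewrite subrr mul0r cexp0 mul1r; apply; apply: filterS H0 => u [].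
have H2 : \forall u \near t, complex.Im (cexp ((u - t)%:C * - k) * w u) = complex.Im (w t).
  have := @near0_derive_cst (fun s => complex.Im (cexp ((s - t)%:C * - k) * w s)) t.
  by rewrite subrr mul0r cexp0 mul1r; apply; apply: filterS H0 => u [].
near=> u.
have -> : w t = cexp ((u - t)%:C * - k) * w u.
  by apply: complex_ext; apply/esym; near: u.
by rewrite mulrA -cexpD mulrN subrr cexp0 mul1r.
Unshelve. all: by end_near. Qed.

Definition ofC2 (z : C * C) : R4 :=
  ((complex.Re z.1, complex.Im z.1), (complex.Re z.2, complex.Im z.2)).

Lemma ofC2K z : toC2 (ofC2 z) = z.
Proof. by case: z => [[? ?] [? ?]]. Qed.
Lemma toC2K z : ofC2 (toC2 z) = z.
Proof. by case: z => [[? ?] [? ?]]. Qed.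

Lemma is_derive_lincomp (V W : normedModType R) (h : {linear V -> W})
    (c : R -> V) (u : R) (v : V) : continuous h ->
  is_derive u (1 : R) c v -> is_derive u (1 : R) (fun s => h (c s)) (h v).
Proof.
move=> ch dc.
have cd : differentiable c u by apply/derivable1_diffP; case: dc.
have hd x : differentiable h x by exact: linear_differentiable.
have hc : differentiable (fun s => h (c s)) u by apply: (differentiable_comp cd).
have := diff_is_derive (1 : R) hc.
have E := congr1 (@^~ (1 : R)) (diff_comp cd (hd (c u))); rewrite /= in E.
rewrite [X in is_derive _ _ _ X]E (diff_lin _ ch) -(deriveE (1 : R) cd).
by rewrite (@derive_val _ _ _ _ _ _ _ dc).
Qed.

Lemma is_derive_pair (V W : normedModType R) (f : R -> V) (g : R -> W) (u : R) a b :
  is_derive u (1 : R) f a -> is_derive u (1 : R) g b ->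
  is_derive u (1 : R) (fun s => (f s, g s)) (a, b).
Proof.
move=> df dg.
have fd : differentiable f u by apply/derivable1_diffP; case: df.
have gd : differentiable g u by apply/derivable1_diffP; case: dg.
have fgd : differentiable (fun s => (f s, g s)) u by exact: differentiable_pair.
have := diff_is_derive (1 : R) fgd.
have E := congr1 (@^~ (1 : R)) (diff_pair fd gd); rewrite /= in E.
rewrite [X in is_derive _ _ _ X]E -(deriveE (1 : R) fd) -(deriveE (1 : R) gd).
by rewrite (@derive_val _ _ _ _ _ _ _ df) (@derive_val _ _ _ _ _ _ _ dg).
Qed.

Lemma continuous_fst (V W : normedModType R) : continuous (@fst V W).
Proof. by move=> x; exact: cvg_fst. Qed.
Lemma continuous_snd (V W : normedModType R) : continuous (@snd V W).
Proof. by move=> x; exact: cvg_snd. Qed.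

Lemma is_derive_toC2 (c : R -> R4) (u : R) (v : R4) :
  is_derive u (1 : R) c v <->
  cderiv (fun s => (toC2 (c s)).1) u (toC2 v).1 /\
  cderiv (fun s => (toC2 (c s)).2) u (toC2 v).2.
Proof.
split=> [dc|[[d1 d2] [d3 d4]]].
  have dp := is_derive_lincomp (@continuous_fst _ _) dc.
  have dq := is_derive_lincomp (@continuous_snd _ _) dc.
  split; split.
  - exact: (is_derive_lincomp (@continuous_fst _ _) dp).
  - exact: (is_derive_lincomp (@continuous_snd _ _) dp).
  - exact: (is_derive_lincomp (@continuous_fst _ _) dq).
  - exact: (is_derive_lincomp (@continuous_snd _ _) dq).
have := is_derive_pair (is_derive_pair d1 d2) (is_derive_pair d3 d4).
rewrite /= (_ : (fun s => _) = c); last first.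
  by apply/funext => s; case: (c s) => [[? ?] [? ?]].
by case: (v) => [[? ?] [? ?]].
Qed.

(** Nondegeneracy of the symplectic form: the Hamiltonian vector is unique. *)
Lemma omega0_inj (v v' : R4) : (forall w, omega0 v w = omega0 v' w) -> v = v'.
Proof.
move=> H; have := H ((0,0),(1,0)); have := H ((0,0),(0,1)).
have := H ((1,0),(0,0)); have := H ((0,1),(0,0)).
case: v H => [[a b] [c d]]; case: v' => [[a' b'] [c' d']] _.
rewrite /omega0 /= !mulr0 !mulr1 !sub0r !subr0 ?addr0 ?add0r ?subrr ?addr0 ?add0r.
by move=> h1 h2 h3 ->; congr ((_, _), (_, _)); lra.
Qed.

End ComplexCurves.
(** * Smooth complex-valued functions *)

Lemma near_ltr (R : realType) (V : normedModType R) (f g : V -> R) x :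
  {for x, continuous f} -> {for x, continuous g} ->
  f x < g x -> \forall y \near x, f y < g y.
Proof.
move=> cf cg fg.
have h : (fun y => g y - f y) @ x --> g x - f x by apply: cvgB; [exact: cg|exact: cf].
have fg0 : 0 < g x - f x by rewrite subr_gt0.
by apply: filterS (cvgr_gt _ h _ fg0) => y; rewrite subr_gt0.
Qed.

Section ComplexSmooth.
Context {R : realType} {V : normedModType R} (U : set V) (oU : open U).
Notation C := (R[i]).
Notation R4 := ((R * R) * (R * R))%type.
Implicit Types (k : nat) (w v : V -> C).

Definition cCk k w : Prop :=
  Ck k U (fun x => complex.Re (w x)) /\ Ck k U (fun x => complex.Im (w x)).

Lemma cCk_cexp k w : cCk k w -> cCk k (fun x => cexp (w x)).
Proof.
move=> [wr wi]; have [c s] := Ck_cos_sin oU wi; have e := Ck_expR oU wr.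
split.
- apply: (Ck_ext oU _ (Ck_mul oU e c)) => x _.
  by rewrite cexpE /cexpi /= mul0r subr0.
- apply: (Ck_ext oU _ (Ck_mul oU e s)) => x _.
  by rewrite cexpE /cexpi /= mul0r addr0.
Qed.

Lemma cCk_mul k w v : cCk k w -> cCk k v -> cCk k (fun x => w x * v x).
Proof.
move=> [wr wi] [vr vi]; split.
- apply: (Ck_ext oU _ (Ck_add oU (Ck_mul oU wr vr) (Ck_opp oU (Ck_mul oU wi vi)))) => x _.
  by case: (w x); case: (v x).
- apply: (Ck_ext oU _ (Ck_add oU (Ck_mul oU wr vi) (Ck_mul oU wi vr))) => x _.
  by case: (w x); case: (v x).
Qed.

Lemma cCk_opp k w : cCk k w -> cCk k (fun x => - w x).
Proof.
move=> [wr wi]; split.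
- by apply: (Ck_ext oU _ (Ck_opp oU wr)) => x _; case: (w x).
- by apply: (Ck_ext oU _ (Ck_opp oU wi)) => x _; case: (w x).
Qed.

Lemma cCk_conj k w : cCk k w -> cCk k (fun x => conjc (w x)).
Proof.
move=> [wr wi]; split.
- by apply: (Ck_ext oU _ wr) => x _; case: (w x).
- by apply: (Ck_ext oU _ (Ck_opp oU wi)) => x _; case: (w x).
Qed.

Lemma cCk_inv k w : (forall x, U x -> w x != 0) -> cCk k w -> cCk k (fun x => (w x)^-1).
Proof.
move=> w0 [wr wi].
have n0 x : U x -> complex.Re (w x) * complex.Re (w x) +
    complex.Im (w x) * complex.Im (w x) != 0.
  move=> /w0; case: (w x) => a b /=; rewrite eq_complex /= => h.
  by rewrite -!expr2 paddr_eq0 ?sqr_ge0// !sqrf_eq0.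
have n := Ck_inv oU n0 (Ck_add oU (Ck_mul oU wr wr) (Ck_mul oU wi wi)).
split.
- by apply: (Ck_ext oU _ (Ck_mul oU wr n)) => x _; case: (w x).
- apply: (Ck_ext oU _ (Ck_opp oU (Ck_mul oU wi n))) => x _.
  by case: (w x) => a b /=; rewrite -!expr2.
Qed.

Lemma cCk_toC2 k (f : V -> R4) : Ck k U f ->
  cCk k (fun x => (toC2 (f x)).1) /\ cCk k (fun x => (toC2 (f x)).2).
Proof.
move=> Cf.
have Cp := Ck_lincomp oU (@continuous_fst _ _ _) Cf.
have Cq := Ck_lincomp oU (@continuous_snd _ _ _) Cf.
split; split.
- exact: (Ck_lincomp oU (@continuous_fst _ _ _) Cp).
- exact: (Ck_lincomp oU (@continuous_snd _ _ _) Cp).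
- exact: (Ck_lincomp oU (@continuous_fst _ _ _) Cq).
- exact: (Ck_lincomp oU (@continuous_snd _ _ _) Cq).
Qed.

Lemma Ck_ofC2 k w v : cCk k w -> cCk k v -> Ck k U (fun x => ofC2 (w x, v x)).
Proof.
move=> [wr wi] [vr vi].
exact: (Ck_pair oU (Ck_pair oU wr wi) (Ck_pair oU vr vi)).
Qed.

Lemma cCk_Hmod k (f : V -> R4) : Ck k U f -> cCk k (fun x => Hmod (toC2 (f x))).
Proof.
move=> /cCk_toC2[Cp Cq]; apply: cCk_opp; apply: cCk_mul => //; exact: cCk_conj.
Qed.

Lemma continuous_normc w x : cCk 0 w -> U x -> {for x, continuous (fun y => normc (w y))}.
Proof.
move=> [wr wi] Ux.
have n := Ck_add oU (Ck_mul oU wr wr) (Ck_mul oU wi wi).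
have -> : (fun y => normc (w y)) = (fun y => Num.sqrt
    (complex.Re (w y) * complex.Re (w y) + complex.Im (w y) * complex.Im (w y))).
  by apply/funext => y; case: (w y).
by apply: (continuous_comp (n x Ux)); exact: sqrt_continuous.
Qed.

End ComplexSmooth.

Section FirstPartials.
Context {R : realType}.

Lemma open_disc (r : R) : open (disc r).
Proof.
have C2 : Ck 0 setT (fun x : R * R => x.1 * x.1 + x.2 * x.2).
  have C1 := Ck_lincomp openT (@continuous_fst _ _ _) (@Ck_id _ (R * R)%type setT 0).
  have C2 := Ck_lincomp openT (@continuous_snd _ _ _) (@Ck_id _ (R * R)%type setT 0).
  exact: (Ck_add openT (Ck_mul openT C1 C1) (Ck_mul openT C2 C2)).
rewrite openE => x; rewrite /disc /= => xr.
have := near_ltr (C2 x I) (@cst_continuous _ _ (r ^+ 2) x).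
by rewrite -!expr2 => /(_ xr); apply: filterS => y; rewrite /= -!expr2.
Qed.

Lemma Ck_derive (k : nat) (r : R) (S : R * R -> R) (v : R * R) :
  smooth_on (disc r) S -> Ck k (disc r) (fun x => 'D_v S x).
Proof.
move=> /(_ k.+1) [dS CS]; apply: (Ck_ext (@open_disc r) _ (CS v)) => x dx.
by rewrite deriveE//; exact: dS.
Qed.

Lemma disc_normc (r : R) (b : R[i]) : normc b < r ->
  disc r (complex.Re b, complex.Im b).
Proof.
case: b => x y /= h; rewrite /disc /=.
have r0 : 0 < r by apply: le_lt_trans h; exact: sqrtr_ge0.
by rewrite -ltr_sqrt ?exprn_gt0// sqrtr_sqr ger0_norm// ltW.
Qed.

End FirstPartials.

(** * The Hamiltonian vector fields *)

Section HamiltonianFields.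
Context {R : realType}.
Notation C := (R[i]).
Notation R4 := ((R * R) * (R * R))%type.

Lemma linear_is_derive (V W : normedModType R) (h : {linear V -> W}) (z w : V) :
  continuous h -> is_derive z w h (h w).
Proof.
move=> ch; have hd : differentiable h z by exact: linear_differentiable.
by have := diff_is_derive w hd; rewrite (diff_lin _ ch).
Qed.

Lemma is_derive_coords (z w : R4) :
  [/\ is_derive z w (fun x : R4 => x.1.1) w.1.1,
      is_derive z w (fun x : R4 => x.1.2) w.1.2,
      is_derive z w (fun x : R4 => x.2.1) w.2.1 &
      is_derive z w (fun x : R4 => x.2.2) w.2.2].
Proof.
split.
- apply: (@linear_is_derive _ _ (@fst R R \o @fst (R * R)%type (R * R)%type)) => x.
  by apply: continuous_comp; exact: continuous_fst.
- apply: (@linear_is_derive _ _ (@snd R R \o @fst (R * R)%type (R * R)%type)) => x.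
  by apply: continuous_comp; [exact: continuous_fst|exact: continuous_snd].
- apply: (@linear_is_derive _ _ (@fst R R \o @snd (R * R)%type (R * R)%type)) => x.
  by apply: continuous_comp; [exact: continuous_snd|exact: continuous_fst].
- apply: (@linear_is_derive _ _ (@snd R R \o @snd (R * R)%type (R * R)%type)) => x.
  by apply: continuous_comp; exact: continuous_snd.
Qed.

Lemma Ck_H1_H2 k : Ck k setT (@H1 R) /\ Ck k setT (@H2 R).
Proof. exact: (cCk_Hmod openT (@Ck_id _ _ _ k)). Qed.

Lemma diff_H1 (z w : R4) : 'd H1 z w =
  - (z.1.1 * w.2.1 + z.2.1 * w.1.1 + (z.1.2 * w.2.2 + z.2.2 * w.1.2)).
Proof.
apply: is_derive_diff; first by have [[h _] _] := Ck_H1_H2 1; exact: h.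
have [d1 d2 d3 d4] := is_derive_coords z w.
have -> : @H1 R = (fun x => - (x.1.1 * x.2.1 + x.1.2 * x.2.2)).
  by apply/funext => -[[a b] [c d]]; rewrite /H1 /Hmod /=; ring.
by apply: is_derive_eq; rewrite /GRing.scale /=.
Qed.

Lemma diff_H2 (z w : R4) : 'd H2 z w =
  - (z.1.1 * w.2.2 + z.2.2 * w.1.1 - (z.1.2 * w.2.1 + z.2.1 * w.1.2)).
Proof.
apply: is_derive_diff; first by have [_ [h _]] := Ck_H1_H2 1; exact: h.
have [d1 d2 d3 d4] := is_derive_coords z w.
have -> : @H2 R = (fun x => - (x.1.1 * x.2.2 - x.1.2 * x.2.1)).
  by apply/funext => -[[a b] [c d]]; rewrite /H2 /Hmod /=; ring.
by apply: is_derive_eq; rewrite /GRing.scale /=.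
Qed.

Lemma hamiltonian_vector_eq (f : R4 -> R) (z v v0 : R4) :
  (forall w, omega0 v0 w = - 'd f z w) -> hamiltonian_vector f z v <-> v = v0.
Proof.
move=> H; split=> [h|->]; last exact: H.
by apply: omega0_inj => w; rewrite h H.
Qed.

Lemma toC2_eq (v : R4) (w : C * C) : toC2 v = w <-> v = ofC2 w.
Proof. by split=> [<-|->]; rewrite ?toC2K ?ofC2K. Qed.

(** Both Hamiltonian vector fields are of the form [(k p, - conj k q)], with [k = 1]
    for [H1] and [k = i] for [H2], so that their flows can be treated together. *)
Lemma hamiltonian_H1 (z v : R4) : hamiltonian_vector H1 z v <->
  toC2 v = (1 * (toC2 z).1, - conjc 1 * (toC2 z).2).
Proof.
rewrite toC2_eq; apply: hamiltonian_vector_eq => w; rewrite diff_H1 opprK.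
by case: z => [[a b] [c d]]; rewrite /omega0 /ofC2 /=; ring.
Qed.

Lemma hamiltonian_H2 (z v : R4) : hamiltonian_vector H2 z v <->
  toC2 v = ((0 +i* 1) * (toC2 z).1, - conjc (0 +i* 1) * (toC2 z).2).
Proof.
rewrite toC2_eq; apply: hamiltonian_vector_eq => w; rewrite diff_H2 opprK.
by case: z => [[a b] [c d]]; rewrite /omega0 /ofC2 /=; ring.
Qed.

End HamiltonianFields.

(** * Powers of a real number greater than one *)

Section RealPowers.
Context {R : realType}.

Lemma expR_mulz (n : int) (x : R) : expR (n%:~R * x) = expR x ^ n.
Proof.
case: n => n; first exact: expRM_natl.
by rewrite NegzE mulrNz mulNr expRN -[(n.+1%:~R)]/(n.+1%:R) expRM_natl exprnN.
Qed.

(** The half-open interval ]1, P] is a fundamental domain for the multiplication by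
    powers of [P] on the positive reals; this lemma gives existence and the next one
    uniqueness. *)
Lemma exists_exprz_itv (P x : R) : 1 < P -> 0 < x ->
  exists n : int, 1 < P ^ n * x <= P.
Proof.
move=> P1 x0; have P0 : 0 < P by exact: lt_trans P1.
have L0 : 0 < ln P by rewrite ln_gt0.
pose L := ln x / ln P.
have xE : x = expR (L * ln P) by rewrite divfK ?lnK// gt_eqF.
(* [P ^ n * x] lies in ]1, P] exactly when [0 < n + L <= 1]. *)
exists (Num.floor (- L) + 1).
have -> : P ^ (Num.floor (- L) + 1) = expR ((Num.floor (- L) + 1)%:~R * ln P).
  by rewrite expR_mulz lnK.
rewrite xE -expRD -mulrDl -[ltLHS]expR0 ltr_expR -[leRHS](lnK P0) ler_expR.
rewrite pmulr_lgt0// ler_piMl ?(ltW L0)//.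
  by have /andP[_] := floor_itv (- L); lra.
have /andP[] := floor_itv (- L).
rewrite intrD.
lra.
Qed.

Lemma exprz_itv_inj (P x y : R) (n : int) : 1 < P -> 1 < x <= P -> 1 < y <= P ->
  x = P ^ n * y -> n = 0.
Proof.
move=> P1 /andP[x1 xP] /andP[y1 yP] E.
have P0 : 0 < P by exact: lt_trans P1.
have aux (m : nat) u v : 1 < v -> u <= P -> u = P ^+ m.+1 * v -> False.
  move=> v1 uP uE.
  have : P < u; last by rewrite ltNge uP.
  rewrite uE exprS -mulrA ltr_pMr//.
  by apply: (lt_le_trans v1); rewrite ler_peMl ?(ltW (lt_trans ltr01 v1))// exprn_ege1// ltW.
case: n E => [[|m]|m] E //; first by case: (aux _ _ _ y1 xP E).
case: (aux m y x) => //.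
by rewrite E mulrA -[_ ^ Negz m]/((P ^+ m.+1)^-1) divff ?mul1r// expf_neq0// gt_eqF.
Qed.

Lemma normcXz (z : R[i]) (n : int) : normc (z ^ n) = normc z ^ n.
Proof.
have H (m : nat) : normc (z ^+ m) = normc z ^+ m.
  by elim: m => [|m IH]; rewrite ?normc1// !exprS normcM IH.
by case: n => n /=; [exact: H|rewrite /exprz normcV H].
Qed.

End RealPowers.

(** * Multipliers and the fundamental domain *)

Local Arguments conjc : simpl never.

Section Model.
Context {R : realType} (S : R * R -> R) (eps del : R).
Hypothesis del_gt0 : 0 < del.
(** The smallness of [eps] and [del]. It makes the period
    larger than [1] in norm, keeps the glued collars [e^S1 <= |p|] and
    [e^(- del) < |q|] disjoint, and puts both of them inside [X']. *)
Hypothesis small : forall b, normc b < eps -> normc b * expR del < expR (S1 S b).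

Notation C := (R[i]).
Notation X := (X eps).
Notation X' := (X' S eps del).
Notation glue := (Defs.glue S eps del).
Notation clos := (clos_refl_sym_trans (C * C) glue).
Notation cls := (cls S eps del).
Notation XS := (XS S eps del).
Notation S1 := (S1 S).
Notation S2 := (S2 S).
Implicit Types (b a c : C) (z w d : C * C).

Definition twist b : C := S1 b +i* S2 b.
(** The quotient of the multipliers of [sigma1 b] and [sigma2 b]. The value [1] at
    [b = 0] reflects that the multiplier of a smooth point of the singular fiber
    is unique. *)
Definition period b : C := if b == 0 then 1 else cexp (twist b) / - conjc b.
(** The exponential [e^t] of the complex time [t] at which the joint flow reaches [z]
    from [sigma2 (H z)]; for [q = 0], where the orbit of [sigma2 0] inside [C^2]
    only contains the [q]-axis, the time is counted from [sigma1 0], and the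
    singular point gets the limit value [0]. *)
Definition multiplier z : C :=
  if z.2 == 0 then z.1 / cexp (twist (Hmod z)) else (conjc z.2)^-1.
Definition eq_mod_period b a c := exists n : int, a = period b ^ n * c.
Definition same_orbit z w :=
  Hmod z = Hmod w /\ eq_mod_period (Hmod z) (multiplier z) (multiplier w).

Lemma period_neq0 b : period b != 0.
Proof.
rewrite /period; case: ifPn => [_|b0]; first exact: oner_neq0.
by rewrite mulf_neq0 ?cexp_neq0// invr_eq0 oppr_eq0 conjc_eq0.
Qed.

Lemma eq_mod_period_refl b a : eq_mod_period b a a.
Proof. by exists 0; rewrite expr0z mul1r. Qed.

Lemma eq_mod_period_sym b a c : eq_mod_period b a c -> eq_mod_period b c a.
Proof.
move=> [n ->]; exists (- n).
by rewrite mulrA -expfzDr ?period_neq0// addNr expr0z mul1r.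
Qed.

Lemma eq_mod_period_trans b a c e :
  eq_mod_period b a c -> eq_mod_period b c e -> eq_mod_period b a e.
Proof.
move=> [n ->] [m ->]; exists (n + m).
by rewrite mulrA -expfzDr ?period_neq0.
Qed.

Lemma eq_mod_period_mul b a a' c c' :
  eq_mod_period b a c -> eq_mod_period b a' c' ->
  eq_mod_period b (a * a') (c * c').
Proof.
move=> [n ->] [m ->]; exists (n + m).
by rewrite mulrACA -expfzDr ?period_neq0.
Qed.

Lemma same_orbit_refl z : same_orbit z z.
Proof. by split=> //; exact: eq_mod_period_refl. Qed.

Lemma same_orbit_sym z w : same_orbit z w -> same_orbit w z.
Proof. by move=> [H E]; split=> //; rewrite -H; exact: eq_mod_period_sym. Qed.

Lemma same_orbit_trans z w v : same_orbit z w -> same_orbit w v -> same_orbit z v.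
Proof.
move=> [H E] [H' E']; split; first by rewrite H.
by apply: eq_mod_period_trans E _; rewrite H.
Qed.

Lemma X_Hmod z : X z <-> normc (Hmod z) < eps.
Proof. by rewrite /Defs.X /Hmod /= normcN !normcM normc_conj. Qed.

Lemma normc_Hmod z : normc (Hmod z) = normc z.1 * normc z.2.
Proof. by rewrite /Hmod normcN !normcM normc_conj. Qed.

Lemma Hmod_eq0 z : (Hmod z == 0) = (z.1 == 0) || (z.2 == 0).
Proof. by rewrite /Hmod oppr_eq0 mulf_eq0 conjc_eq0. Qed.

Lemma conjc_Hmod z : conjc (Hmod z) = - (z.1 * conjc z.2).
Proof. by rewrite /Hmod conjcN conjcM conjcK. Qed.

Lemma multiplier_q z : z.2 != 0 -> multiplier z = (conjc z.2)^-1.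
Proof. by rewrite /multiplier => /negbTE ->. Qed.

(** For [p, q <> 0] the two candidate values of the multiplier differ by one period,
    that is, by one turn through the gluing. *)
Lemma multiplier_p z : z.1 != 0 ->
  eq_mod_period (Hmod z) (multiplier z) (z.1 / cexp (twist (Hmod z))).
Proof.
move=> p0; rewrite /multiplier; case: ifPn => [_|q0]; first exact: eq_mod_period_refl.
exists 1; rewrite expr1z /period Hmod_eq0 (negbTE p0) (negbTE q0) /=.
have e0 := cexp_neq0 (twist (Hmod z)); move: (cexp _) e0 => e e0.
by rewrite conjc_Hmod opprK; field; rewrite conjc_eq0 p0 q0 e0.
Qed.

Lemma multiplier_neq0 z : Hmod z != 0 -> multiplier z != 0.
Proof.
by rewrite Hmod_eq0 => /norP[p0 q0]; rewrite multiplier_q// invr_eq0 conjc_eq0.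
Qed.

Lemma phi12 (t1 t2 : R) z : phi1 t1 (phi2 t2 z) =
  (cexp (t1 +i* t2) * z.1, cexp (- conjc (t1 +i* t2)) * z.2).
Proof. by rewrite /phi1 /phi2 /= !mulrA !cexpE /= opprK. Qed.

Lemma sigma1E b : sigma1 S b = (cexp (twist b), - (cexp (- conjc (twist b)) * b)).
Proof. by rewrite /sigma1 !cexpE /= opprK. Qed.

(** [glue_source b a] and [glue_target b a] are the two points that the gluing
    identifies over [b], parametrized by their multiplier [a = e^(t1 + i t2)]
    relative to the sections; the norm of [a] plays the role of [t1]. *)
Definition glue_source b a := (a * cexp (twist b), - b / conjc (a * cexp (twist b))).
Definition glue_target b a := (- conjc b * a, (conjc a)^-1).

Lemma glue_source_target b a : normc b < eps -> 1 <= normc a < expR del ->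
  glue (glue_source b a) (glue_target b a).
Proof.
move=> beps /andP[a1 ad].
have a0 : a != 0 by rewrite -normc_gt0; exact: lt_le_trans a1.
have [t [tE te t2]] := polar a0.
exists b, (complex.Re t), (complex.Im t); rewrite !phi12 sigma1E /sigma2 /=.
have -> : complex.Re t +i* complex.Im t = t by case: (t).
split=> //.
- by rewrite -ler_expR -ltr_expR expR0 te a1.
- rewrite tE /glue_source -tE; congr pair.
  rewrite conjcM !conjc_cexp !cexpN.
  by rewrite invfM mulNr mulrN mulrC -mulrA.
- by rewrite tE /glue_target -tE mulrC conjc_cexp cexpN mulr1.
Qed.

(** With [t = t1 + i t2], the first point has [p = e^t e^(S1 + i S2)] and the second
    one has [q = e^(- conj t)]: both multipliers are [e^t] modulo the period. *)
Lemma glue_same_orbit z w : glue z w -> same_orbit z w.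
Proof.
move=> [b [t1 [t2 [beps _ _ -> ->]]]]; rewrite !phi12 sigma1E /sigma2.
move: (t1 +i* t2 : C) => t; set s := twist b.
have n0 (u : C) : cexp u != 0 := cexp_neq0 u.
have cc (u : C) : conjc (cexp u) = cexp (conjc u) := conjc_cexp u.
set z1 := (_, _); set z2 := (_, _).
have h1 : Hmod z1 = b.
  rewrite /Hmod /z1 /= conjcM !cc !cexpN.
  by field; rewrite !n0.
have h2 : Hmod z2 = b.
  rewrite /Hmod /z2 /= conjcM !cc !cexpN conjcN conjcK.
  by field; rewrite !n0.
split; first by rewrite h1.
have p0 : z1.1 != 0 by rewrite mulf_neq0 ?n0.
apply: eq_mod_period_trans (multiplier_p p0) _; rewrite h1 -/s.
rewrite (@multiplier_q z2) /z2/=; last by rewrite mulr1.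
rewrite conjcM conjc1 mulr1 cc conjcN conjcK cexpN invrK mulfK//.
exact: eq_mod_period_refl.
Qed.

Lemma clos_same_orbit z w : clos z w -> same_orbit z w.
Proof.
elim=> [x y /glue_same_orbit//|x|x y _|x y v _ h1 _ h2].
- exact: same_orbit_refl.
- exact: same_orbit_sym.
- exact: same_orbit_trans h1 h2.
Qed.

(** One half-open turn around the fibers. The boundary [|p| = e^S1] is kept and the
    boundary [|q| = 1], to which it is glued, is left out: this choice lies inside
    the union of the two open charts. *)
Definition fundom : set (C * C) :=
  [set z | [/\ X z, normc z.2 < 1 & normc z.1 <= expR (S1 (Hmod z))]].

Lemma small0 b : normc b < eps -> normc b < expR (S1 b).
Proof.
move=> /small; apply: le_lt_trans.
by rewrite ler_peMr ?normc_ge0// -expR0 ler_expR ltW.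
Qed.

Lemma fundom_X' z : fundom z -> X' z.
Proof.
move=> [Xz q1 pS]; split=> //; first exact: ltW.
by apply: le_lt_trans pS _; rewrite ltr_expR ltrDl.
Qed.

Lemma normc_period b : b != 0 -> normc (period b) = expR (S1 b) / normc b.
Proof.
by move=> /negbTE b0; rewrite /period b0 normcM normcV normcN normc_conj normc_cexp.
Qed.

Lemma normc_period_gt1 b : b != 0 -> normc b < eps -> 1 < normc (period b).
Proof.
move=> b0 be; rewrite normc_period// ltr_pdivlMr ?normc_gt0// mul1r.
exact: small0.
Qed.

Lemma fundom_multiplier_itv z : fundom z -> Hmod z != 0 ->
  1 < normc (multiplier z) <= normc (period (Hmod z)).
Proof.
move=> [Xz q1 pS] H0; rewrite normc_period//.
have := H0; rewrite Hmod_eq0 => /norP[p0 q0].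
have np : 0 < normc z.1 by rewrite normc_gt0.
have nq : 0 < normc z.2 by rewrite normc_gt0.
rewrite multiplier_q// normcV normc_conj invf_gt1// q1/=.
rewrite ler_pdivlMr ?normc_gt0// normc_Hmod.
by rewrite mulrCA mulVf ?mulr1// gt_eqF.
Qed.

(** Over [b <> 0] the norms of both multipliers are in ]1, |period|], so that the
    power of the period that relates them is trivial. *)
Lemma fundom_inj z w : fundom z -> fundom w -> same_orbit z w -> z = w.
Proof.
move=> Fz Fw [H [n E]].
have [H0|H0] := eqVneq (Hmod z) 0; last first.
  have H0' : Hmod w != 0 by rewrite -H.
  have n0 : n = 0.
    apply: (@exprz_itv_inj _ (normc (period (Hmod z)))
              (normc (multiplier z)) (normc (multiplier w))).
    - by apply: normc_period_gt1 => //; apply/X_Hmod; case: Fz.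
    - exact: fundom_multiplier_itv.
    - by rewrite H; exact: fundom_multiplier_itv.
    - by rewrite E normcM normcXz.
  move: E; rewrite n0 expr0z mul1r.
  have := H0; rewrite Hmod_eq0 => /norP[p0 q0].
  have := H0'; rewrite Hmod_eq0 => /norP[p0' q0'].
  rewrite !multiplier_q// => /invr_inj /(congr1 conjc); rewrite !conjcK => qq.
  move: H; rewrite /Hmod qq => /oppr_inj /(mulIf q0') /(congr1 conjc).
  rewrite !conjcK => pp; move: pp qq.
  by case: (z) => ? ?; case: (w) => ? ? /= -> ->.
move: E; rewrite /period H0 eqxx exp1rz mul1r => E.
have H0' : Hmod w = 0 by rewrite -H.
(* On the zero fiber the period is [1] and the two axes are told apart by the
   norm of the multiplier: greater than [1] on the punctured [q]-axis, at most
   [1] on the [p]-axis. *)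
have key v : fundom v -> Hmod v = 0 -> normc (multiplier v) <= 1 -> v.2 = 0.
  move=> [_ q1 _] Hv; apply: contraTeq => q0; rewrite -ltNge multiplier_q//.
  by rewrite normcV normc_conj invf_gt1// normc_gt0.
have key2 v : fundom v -> Hmod v = 0 -> v.2 = 0 -> normc (multiplier v) <= 1.
  move=> [_ _ pS] Hv q0; rewrite /multiplier q0 eqxx normcM normcV normc_cexp /=.
  by rewrite ler_pdivrMr ?expR_gt0// mul1r.
have [q0|q0] := eqVneq z.2 0.
  have q0' : w.2 = 0 by apply: key => //; rewrite -E; exact: key2.
  move: E; rewrite /multiplier q0 q0' eqxx H0 H0' => /(mulIf _) pp.
  have {}pp := pp (invr_neq0 (cexp_neq0 _)).
  by move: pp q0 q0'; case: (z) => ? ?; case: (w) => ? ? /= -> -> ->.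
have q0' : w.2 != 0.
  by apply: contra_neq q0 => q0; apply: key => //; rewrite E; exact: key2.
have p0 : z.1 = 0 by have /eqP := H0; rewrite Hmod_eq0 (negbTE q0) orbF => /eqP.
have p0' : w.1 = 0 by have /eqP := H0'; rewrite Hmod_eq0 (negbTE q0') orbF => /eqP.
move: E; rewrite !multiplier_q// => /invr_inj /(congr1 conjc); rewrite !conjcK.
by move: p0 p0'; case: (z) => ? ?; case: (w) => ? ? /= -> -> ->.
Qed.

Lemma Hmod_glue_source b a : a != 0 -> Hmod (glue_source b a) = b.
Proof.
move=> a0; rewrite /Hmod /glue_source /=.
rewrite mulNr mulrN opprK mulrC divfK// conjc_eq0 mulf_neq0// cexp_neq0//.
Qed.

Lemma Hmod_glue_target b a : a != 0 -> Hmod (glue_target b a) = b.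
Proof.
move=> a0; rewrite /Hmod /glue_target /= conjcM conjcN conjcK.
by rewrite mulfK ?opprK// conjc_eq0.
Qed.

Lemma glue_sourceE z : z.1 != 0 -> z = glue_source (Hmod z) (z.1 / cexp (twist (Hmod z))).
Proof.
move=> p0; rewrite /glue_source divfK ?cexp_neq0// /Hmod opprK mulrC mulKf ?conjc_eq0//.
by case: (z).
Qed.

Lemma glue_targetE z : z.2 != 0 -> z = glue_target (Hmod z) (conjc z.2)^-1.
Proof.
move=> q0; rewrite /glue_target conjc_Hmod opprK mulfK ?conjc_eq0//.
by rewrite conjc_inv conjcK invrK; case: (z).
Qed.

(** A single application of the gluing brings a point of [X'] into the fundamental
    domain. *)
Lemma X'_fundom z : X' z -> exists2 d, fundom d & clos z d.
Proof.
move=> [Xz q1 pS]; have be := (X_Hmod z).1 Xz.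
have [q1'|q1'] := ltP (normc z.2) 1; last first.
  (* [|q| = 1]: glue backwards, which lands on [|p| = e^S1]. *)
  have q11 : normc z.2 = 1 by apply/eqP; rewrite eq_le q1 q1'.
  have q0 : z.2 != 0 by rewrite -normc_gt0 q11.
  pose a := (conjc z.2)^-1.
  have a1 : normc a = 1 by rewrite /a normcV normc_conj q11 invr1.
  have a0 : a != 0 by rewrite -normc_gt0 a1.
  exists (glue_source (Hmod z) a); last first.
    apply: rst_sym; apply: rst_step; rewrite {2}(glue_targetE q0).
    by apply: glue_source_target => //; rewrite a1 lexx -expR0 ltr_expR.
  split; first by apply/X_Hmod; rewrite Hmod_glue_source.
    rewrite /glue_source /= normcM normcN normcV normc_conj normcM a1 mul1r normc_cexp /=.
    by rewrite ltr_pdivrMr ?expR_gt0// mul1r small0.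
  by rewrite Hmod_glue_source// /glue_source /= normcM a1 mul1r normc_cexp.
have [pS'|pS'] := leP (normc z.1) (expR (S1 (Hmod z))).
  by exists z; [split|exact: rst_refl].
(* [|p| > e^S1]: glue forwards. *)
have p0 : z.1 != 0 by rewrite -normc_gt0; apply: lt_trans pS'; exact: expR_gt0.
pose a := z.1 / cexp (twist (Hmod z)).
have aE : normc a = normc z.1 / expR (S1 (Hmod z)) by rewrite normcM normcV normc_cexp.
have a1 : 1 < normc a by rewrite aE ltr_pdivlMr ?expR_gt0// mul1r.
have ad : normc a < expR del.
  by rewrite aE ltr_pdivrMr ?expR_gt0// -expRD addrC.
have a0 : a != 0 by rewrite -normc_gt0; exact: lt_trans a1.
exists (glue_target (Hmod z) a); last first.
  apply: rst_step; rewrite {1}(glue_sourceE p0).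
  by apply: glue_source_target => //; rewrite ltW.
split; first by apply/X_Hmod; rewrite Hmod_glue_target.
  by rewrite /glue_target /= normcV normc_conj invf_lt1// (lt_trans _ a1).
rewrite Hmod_glue_target// /glue_target /= normcM normcN normc_conj.
apply: le_trans (ltW (small be)).
by apply: ler_wpM2l; rewrite ?normc_ge0 ?ltW.
Qed.

(** Two points with the same multiplier are both glued to points of the fundamental
    domain, which coincide by [fundom_inj]. *)
Lemma clsE z : X' z -> cls z = [set w | X' w /\ same_orbit z w].
Proof.
move=> Xz; apply/seteqP; split=> w /= [Xw]; first by move=> /clos_same_orbit.
move=> zw; split=> //.
have [d Fd zd] := X'_fundom Xz; have [d' Fd' wd] := X'_fundom Xw.
have dd : d = d'.
  apply: fundom_inj => //; apply: same_orbit_trans (same_orbit_sym (clos_same_orbit zd)) _.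
  exact: same_orbit_trans zw (clos_same_orbit wd).
by apply: rst_trans zd _; rewrite dd; apply: rst_sym.
Qed.

Lemma cls_mem z : X' z -> cls z z.
Proof. by move=> Xz; rewrite clsE//; split=> //; exact: same_orbit_refl. Qed.

Lemma cls_eqP z w : X' z -> X' w -> cls z = cls w <-> same_orbit z w.
Proof.
move=> Xz Xw; split=> [E|zw].
  by have := cls_mem Xw; rewrite -E clsE// => -[].
rewrite (clsE Xz) (clsE Xw); apply/seteqP; split=> v /= [Xv h]; split; [exact: Xv| |exact: Xv|].
  exact: same_orbit_trans (same_orbit_sym zw) h.
exact: same_orbit_trans zw h.
Qed.

Lemma HS_cls z : X' z -> HS (cls z) = Hmod z.
Proof.
move=> Xz; rewrite /HS; apply: xget_unique; first by exists z => //; exact: cls_mem.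
by move=> b [w]; rewrite clsE// => -[_ [-> _]] <-.
Qed.

Lemma XS_cls z : X' z -> XS (cls z).
Proof. by move=> Xz; exists z. Qed.

Lemma XS_fundom x : XS x -> exists2 d, fundom d & x = cls d.
Proof.
move=> [z Xz <-]; have [d Fd zd] := X'_fundom Xz; exists d => //.
by apply/(cls_eqP Xz (fundom_X' Fd)); exact: clos_same_orbit.
Qed.

Lemma U1_X' : U1 S eps `<=` X'.
Proof.
move=> z [Xz q1 pS]; split=> //; first exact: ltW.
by apply: lt_trans pS _; rewrite ltr_expR ltrDl.
Qed.

Lemma U2_X' : U2 S eps del `<=` X'.
Proof.
move=> z [Xz pS pS']; split=> //.
have be := (X_Hmod z).1 Xz; have := small be.
rewrite normc_Hmod; move: pS; rewrite expRD expRN => pS sm.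
rewrite leNgt; apply/negP => q1.
have : expR (S1 (Hmod z)) < normc z.1 * normc z.2 * expR del.
  rewrite -ltr_pdivrMr ?expR_gt0//; apply: (lt_le_trans pS).
  by rewrite ler_peMr ?normc_ge0// ltW.
by rewrite ltNge ltW.
Qed.

Lemma charts_X' U : charts S eps del U -> U `<=` X'.
Proof. by move=> [->|->]; [exact: U1_X'|exact: U2_X']. Qed.

Lemma fundom_chart d : fundom d -> exists2 U, charts S eps del U & U d.
Proof.
move=> [Xd q1]; rewrite le_eqVlt => /predU1P[pS|pS].
  exists (U2 S eps del); first by right.
  by split=> //; rewrite pS ltr_expR ?ltrDl// ltrBlDr ltrDl.
by exists (U1 S eps) => //; left.
Qed.

(** The powers of the period move any nonzero multiplier into the annulus of the
    fundamental domain. *)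
Lemma exists_multiplier b a : normc b < eps -> b != 0 -> a != 0 ->
  exists d, [/\ fundom d, Hmod d = b & eq_mod_period b (multiplier d) a].
Proof.
move=> be b0 a0; have P1 := normc_period_gt1 b0 be.
have [|n /andP[n1 nP]] := @exists_exprz_itv _ (normc (period b)) (normc a) P1.
  by rewrite normc_gt0.
pose c := period b ^ n * a.
have nc : normc c = normc (period b) ^ n * normc a by rewrite normcM normcXz.
have c0 : c != 0 by rewrite mulf_neq0// expfz_neq0// period_neq0.
exists (glue_target b c); split; last 2 first.
- exact: Hmod_glue_target.
- by exists n; rewrite multiplier_q /glue_target /= ?invr_eq0 ?conjc_eq0// conjc_inv conjcK invrK.
split; first by apply/X_Hmod; rewrite Hmod_glue_target.
  by rewrite /glue_target /= normcV normc_conj invf_lt1 nc// (lt_trans _ n1).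
rewrite Hmod_glue_target// /glue_target /= normcM normcN normc_conj nc.
move: nP; rewrite [leRHS]normc_period// ler_pdivlMr ?normc_gt0//.
by rewrite mulrC.
Qed.

(** * The fiberwise addition *)

(** The graph of the fiberwise addition on representatives; it also covers the
    singular fiber, where the multiplier of the singular point is [0]. *)
Definition is_sum z z' w := [/\ Hmod z = Hmod z', Hmod w = Hmod z &
  eq_mod_period (Hmod z) (multiplier w) (multiplier z * multiplier z')].

Lemma is_sumC z z' w : is_sum z z' w -> is_sum z' z w.
Proof. by move=> [h1 h2 h3]; split; rewrite -?h1// mulrC. Qed.

Lemma is_sum_orbit z z' w z1 z1' w1 :
  same_orbit z z1 -> same_orbit z' z1' -> same_orbit w w1 ->
  is_sum z z' w -> is_sum z1 z1' w1.
Proof.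
move=> [h1 e1] [h2 e2] [h3 e3] [H1 H2 H3]; split.
- by rewrite -h1 H1.
- by rewrite -h3 H2.
- rewrite -h1; rewrite H2 in e3; rewrite -H1 in e2.
  apply: eq_mod_period_trans (eq_mod_period_sym e3) _; apply: eq_mod_period_trans H3 _.
  exact: eq_mod_period_mul.
Qed.

Lemma is_sum_unique z z' w w' : is_sum z z' w -> is_sum z z' w' -> same_orbit w w'.
Proof.
move=> [h1 h2 h3] [h1' h2' h3']; split; first by rewrite h2 h2'.
by rewrite h2; apply: eq_mod_period_trans h3 (eq_mod_period_sym h3').
Qed.

(** All representatives of all sums of representatives; [fiber_add_cls] shows that
    they form a single class. *)
Definition fiber_add (x y : set (C * C)) : set (C * C) :=
  [set w | X' w /\ exists z z', [/\ x z, y z' & is_sum z z' w]].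

Lemma fiber_add_cls z z' w : X' z -> X' z' -> X' w -> is_sum z z' w ->
  fiber_add (cls z) (cls z') = cls w.
Proof.
move=> Xz Xz' Xw sw; rewrite !clsE//; apply/seteqP; split=> v /=.
  move=> [Xv [z1 [z1' [[_ h] [_ h'] sv]]]]; split=> //.
  by apply: is_sum_unique sw _; apply: is_sum_orbit sv;
    [exact: same_orbit_sym|exact: same_orbit_sym|exact: same_orbit_refl].
move=> [Xv wv]; split=> //; exists z, z'; split; [by split=> //; exact: same_orbit_refl..|].
by apply: is_sum_orbit sw => //; exact: same_orbit_refl.
Qed.

(** The sum of multipliers written in the coordinates [q] and [p] respectively, with
    the division by [b] cleared by means of [- conj b = p conj q = p' conj q']. *)
Definition add_q z z' := (z.1 / conjc z'.2, z.2 * z'.2).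
Definition add_p z z' := (z.1 * z'.1 / cexp (twist (Hmod z)),
  z'.2 * cexp (conjc (twist (Hmod z))) / conjc z.1).

Lemma add_qP z z' : Hmod z = Hmod z' -> z'.2 != 0 -> is_sum z z' (add_q z z').
Proof.
move=> H q0.
have HQ : Hmod (add_q z z') = Hmod z.
  rewrite /add_q /Hmod /= conjcM conjc_inv conjcK; congr (- _).
  by field; rewrite q0.
split=> //.
suff -> : multiplier (add_q z z') = multiplier z * multiplier z' by exact: eq_mod_period_refl.
rewrite (multiplier_q q0); have [q00|q00] := eqVneq z.2 0.
  rewrite /multiplier HQ /add_q /= q00 mul0r eqxx.
  by rewrite mulrAC.
rewrite multiplier_q /add_q /= ?mulf_neq0// multiplier_q//.
by rewrite conjcM invfM.
Qed.

(** If [p'] is nonzero, all multipliers can be read off [p]. Otherwise [b = 0], the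
    first point is on the [p]-axis and the sum is on the [q]-axis. *)
Lemma add_pP z z' : Hmod z = Hmod z' -> z.1 != 0 -> is_sum z z' (add_p z z').
Proof.
move=> H p0; set e := cexp (twist (Hmod z)).
have e0 : e != 0 by exact: cexp_neq0.
have ce : cexp (conjc (twist (Hmod z))) = conjc e by rewrite conjc_cexp.
have HP : Hmod (add_p z z') = Hmod z.
  rewrite H /add_p ce -/e /Hmod /= !conjcM conjc_inv; congr (- _).
  by field; rewrite !conjc_eq0 p0 e0.
split=> //; have [p0'|p0'] := eqVneq z'.1 0; last first.
  have p0s : (add_p z z').1 != 0 by rewrite /add_p /= !mulf_neq0 ?invr_eq0.
  have := multiplier_p p0s; rewrite HP => /eq_mod_period_trans; apply.
  have h2 := multiplier_p p0'; rewrite -H -/e in h2.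
  have h3 := eq_mod_period_mul (multiplier_p p0) h2; rewrite -/e in h3.
  apply: eq_mod_period_trans (eq_mod_period_sym h3).
  suff -> : (add_p z z').1 / e = z.1 / e * (z'.1 / e) by exact: eq_mod_period_refl.
  by rewrite /add_p /= -/e; field.
suff -> : multiplier (add_p z z') = multiplier z * multiplier z' by exact: eq_mod_period_refl.
have H0 : Hmod z = 0 by apply/eqP; rewrite H Hmod_eq0 p0' eqxx.
have q0 : z.2 = 0 by have /eqP := H0; rewrite Hmod_eq0 (negbTE p0) => /eqP.
have mz : multiplier z = z.1 / e by rewrite /multiplier q0 eqxx.
have [q0'|q0'] := eqVneq z'.2 0.
  by rewrite /multiplier /add_p /= p0' q0' !mul0r mulr0 !mul0r eqxx mulr0.
rewrite mz !multiplier_q // /add_p /= ce ?mulf_neq0 ?invr_eq0 ?conjc_eq0//.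
rewrite !conjcM conjc_inv !conjcK.
by field; rewrite conjc_eq0 p0 e0 q0'.
Qed.

(** The first formula has [|q q'| < 1] and needs [|p / q'| <= e^S1]; the second one
    has [|p p'| / e^S1 <= e^S1] and needs [|q'| e^S1 / |p| < 1]. The two conditions
    are complementary. *)
Lemma fundom_sum_half z z' : fundom z -> fundom z' -> Hmod z = Hmod z' ->
  (z.1 != 0) || (z'.2 != 0) ->
  (z'.2 != 0 /\ fundom (add_q z z')) \/ (z.1 != 0 /\ fundom (add_p z z')).
Proof.
move=> [Xz q1 pS] [Xz' q1' pS'] H n0; rewrite -H in pS'.
have e0 := expR_gt0 (S1 (Hmod z)).
have [le|lt] := leP (normc z.1) (expR (S1 (Hmod z)) * normc z'.2).
  left; have q0 : z'.2 != 0.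
    apply/eqP => q0; move: n0; rewrite q0 eqxx orbF => /negP; apply.
    by move: le; rewrite q0 normc0 mulr0 -normc_eq0 eq_le normc_ge0 andbT.
  split; [exact: q0|have [_ HQ _] := add_qP H q0].
  split; first by apply/X_Hmod; rewrite HQ; apply/X_Hmod.
    by rewrite /add_q /= normcM mulr_ilt1 ?normc_ge0.
  rewrite HQ /add_q /= normcM normcV normc_conj.
  by rewrite ler_pdivrMr ?normc_gt0.
right; have p0 : z.1 != 0.
  by rewrite -normc_gt0; apply: le_lt_trans lt; rewrite mulr_ge0 ?normc_ge0 ?ltW.
split; [exact: p0|have [_ HP _] := add_pP H p0].
split; first by apply/X_Hmod; rewrite HP; apply/X_Hmod.
  rewrite /add_p /= !normcM normcV normc_conj normc_cexp /=.
  by rewrite ltr_pdivrMr ?normc_gt0// mul1r mulrC.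
rewrite HP /add_p /= !normcM normcV normc_cexp /=.
rewrite ler_pdivrMr//; apply: ler_pM => //; exact: normc_ge0.
Qed.

(** The formulas of [fundom_sum_half] need [p] or [q'] to be nonzero, those with the
    summands exchanged need [p'] or [q] to be nonzero. All four coordinates vanish
    only at the pair of singular points. *)
Lemma fundom_sum_formula z z' : fundom z -> fundom z' -> Hmod z = Hmod z' ->
  (z, z') <> ((0, 0), (0, 0)) ->
  [\/ z'.2 != 0 /\ fundom (add_q z z'), z.1 != 0 /\ fundom (add_p z z'),
      z.2 != 0 /\ fundom (add_q z' z) | z'.1 != 0 /\ fundom (add_p z' z)].
Proof.
move=> Fz Fz' H n0.
have [h|/norP[]] := boolP ((z.1 != 0) || (z'.2 != 0)).
  by case: (fundom_sum_half Fz Fz' H h) => ?; [constructor 1|constructor 2].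
rewrite !negbK => /eqP p0 /eqP q0'.
have h : (z'.1 != 0) || (z.2 != 0).
  apply: contra_notT n0 => /norP[]; rewrite !negbK => /eqP p0' /eqP q0.
  by move: p0 q0 p0' q0'; case: (z) => ? ?; case: (z') => ? ? /= -> -> -> ->.
by case: (fundom_sum_half Fz' Fz (esym H) h) => ?; [constructor 3|constructor 4].
Qed.

Lemma fundom_sum_exists z z' : fundom z -> fundom z' -> Hmod z = Hmod z' ->
  (z, z') <> ((0, 0), (0, 0)) -> exists2 w, fundom w & is_sum z z' w.
Proof.
move=> Fz Fz' H n0; case: (fundom_sum_formula Fz Fz' H n0) => -[h F]; eexists; eauto.
- exact: add_qP.
- exact: add_pP.
- by apply: is_sumC; apply: add_qP.
- by apply: is_sumC; apply: add_pP.
Qed.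

Lemma punctured_fundom x y : punctured_fiber_product S eps del (x, y) ->
  exists d d', [/\ fundom d /\ x = cls d, fundom d' /\ y = cls d', Hmod d = Hmod d' &
    (d, d') <> ((0, 0), (0, 0))].
Proof.
move=> [[/= /XS_fundom[d Fd ->] /XS_fundom[d' Fd' ->]]].
rewrite !HS_cls; [|exact: fundom_X'..] => H n0.
by exists d, d'; split=> // -[dE dE']; apply: n0; rewrite dE dE'.
Qed.

Lemma fiber_add_XS x y : punctured_fiber_product S eps del (x, y) ->
  XS (fiber_add x y) /\ HS (fiber_add x y) = HS x.
Proof.
move=> /punctured_fundom[d [d' [[Fd ->] [Fd' ->] H n0]]].
have [w Fw s] := fundom_sum_exists Fd Fd' H n0.
have [Xd Xd' Xw] := And3 (fundom_X' Fd) (fundom_X' Fd') (fundom_X' Fw).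
rewrite (fiber_add_cls Xd Xd' Xw s) !HS_cls//; split; first exact: XS_cls.
by case: s.
Qed.

(** * The Hamiltonian flows on the regular fibers *)

(** The class of the points over [b] with multiplier [a], an element of
    [C^* / period^Z] for [b <> 0]. *)
Definition fiber_point b a : set (C * C) :=
  [set w | [/\ X' w, Hmod w = b & eq_mod_period b (multiplier w) a]].

Lemma cls_fiber_point z b a : X' z ->
  cls z = fiber_point b a <-> Hmod z = b /\ eq_mod_period b (multiplier z) a.
Proof.
move=> Xz; split=> [E|[zb za]].
  by have := cls_mem Xz; rewrite E => -[_ h1 h2].
rewrite (clsE Xz); apply/seteqP; split=> w /=.
  move=> [Xw [h1 h2]]; split; [exact: Xw|by rewrite -h1|].
  by apply: eq_mod_period_trans (eq_mod_period_sym _) za; rewrite -zb.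
move=> [Xw h1 h2]; split; first exact: Xw.
split; first by rewrite zb.
by rewrite zb; apply: eq_mod_period_trans za (eq_mod_period_sym h2).
Qed.

Lemma fiber_point_rep b a : normc b < eps -> b != 0 -> a != 0 ->
  exists d, [/\ fundom d, Hmod d = b, eq_mod_period b (multiplier d) a & cls d = fiber_point b a].
Proof.
move=> be b0 a0; have [d [Fd db da]] := exists_multiplier be b0 a0.
by exists d; split; [exact: Fd|exact: db|exact: da|apply/(cls_fiber_point _ _ (fundom_X' Fd))].
Qed.

Lemma fiber_pointP x : XS x -> HS x != 0 ->
  exists a, [/\ a != 0, normc (HS x) < eps & x = fiber_point (HS x) a].
Proof.
move=> /XS_fundom[d Fd ->]; rewrite (HS_cls (fundom_X' Fd)) => b0.
exists (multiplier d); split; first exact: multiplier_neq0.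
  by apply/X_Hmod; case: Fd.
by apply/(cls_fiber_point _ _ (fundom_X' Fd)); split=> //; exact: eq_mod_period_refl.
Qed.

Lemma fiber_add_point b a a' : normc b < eps -> b != 0 -> a != 0 -> a' != 0 ->
  fiber_add (fiber_point b a) (fiber_point b a') = fiber_point b (a * a').
Proof.
move=> be b0 a0 a'0.
have [d [Fd db da <-]] := fiber_point_rep be b0 a0.
have [d' [Fd' db' da' <-]] := fiber_point_rep be b0 a'0.
have [w [Fw wb wa <-]] := fiber_point_rep be b0 (mulf_neq0 a0 a'0).
apply: fiber_add_cls; [exact: fundom_X'..|split; [by rewrite db db'|by rewrite wb db|]].
by rewrite db; apply: eq_mod_period_trans wa (eq_mod_period_sym _); exact: eq_mod_period_mul.
Qed.

Lemma sigmaS_fiber_point b : normc b < eps -> b != 0 -> sigmaS S eps del b = fiber_point b 1.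
Proof.
move=> be b0.
have Hb : Hmod (sigma2 b) = b by rewrite /Hmod /sigma2 /= mulr1 conjcN conjcK opprK.
apply/cls_fiber_point; last first.
  split; first exact: Hb.
  by rewrite multiplier_q /sigma2 /= ?oner_neq0// conjc1 invr1; exact: eq_mod_period_refl.
split; first by apply/X_Hmod; rewrite Hb.
  by rewrite /sigma2 /= expr1n expr0n addr0 sqrtr1.
rewrite Hb /sigma2 /= normcN normc_conj; apply: lt_trans (small0 be) _.
by rewrite ltr_expR ltrDl.
Qed.

Definition flow_map (t : C) z : C * C := (cexp t * z.1, cexp (- conjc t) * z.2).

Lemma Hmod_flow_map t z : Hmod (flow_map t z) = Hmod z.
Proof.
rewrite /Hmod /flow_map /= conjcM conjc_cexp cexpN; congr (- _).
by field; exact: cexp_neq0.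
Qed.

Lemma multiplier_flow_map t z : Hmod z != 0 ->
  multiplier (flow_map t z) = cexp t * multiplier z.
Proof.
rewrite Hmod_eq0 => /norP[_ q0].
have q0' : (flow_map t z).2 != 0 by rewrite mulf_neq0 ?cexp_neq0.
rewrite !multiplier_q// /flow_map /= conjcM conjc_cexp conjcN conjcK cexpN.
by rewrite invfM invrK.
Qed.

Section Flow.
Variables (f : (R * R) * (R * R) -> R) (k : C).
Hypothesis ham : forall z v : (R * R) * (R * R), hamiltonian_vector f z v <->
  toC2 v = (k * (toC2 z).1, - conjc k * (toC2 z).2).
Hypothesis chart_open : forall U, charts S eps del U ->
  open [set z : (R * R) * (R * R) | U (toC2 z)].

(** Inside a chart the Hamiltonian equations are linear, and decouple in [p] and
    [q]. *)
Lemma integral_curve_flow_map (c : R -> (R * R) * (R * R)) (t : R) :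
  (\forall u \near t, exists2 v, is_derive u (1 : R) c v & hamiltonian_vector f (c u) v) ->
  \forall u \near t, toC2 (c u) = flow_map ((u - t)%:C * k) (toC2 (c t)).
Proof.
move=> H.
have Hp : \forall u \near t, cderiv (fun s => (toC2 (c s)).1) u (k * (toC2 (c u)).1).
  by apply: filterS H => u [v /is_derive_toC2[dp _] /ham ve]; rewrite ve in dp.
have Hq : \forall u \near t, cderiv (fun s => (toC2 (c s)).2) u (- conjc k * (toC2 (c u)).2).
  by apply: filterS H => u [v /is_derive_toC2[_ dq] /ham ve]; rewrite ve in dq.
have Ep := cderiv_linear_ODE Hp; have Eq := cderiv_linear_ODE Hq.
near=> u.
have ep : (toC2 (c u)).1 = cexp ((u - t)%:C * k) * (toC2 (c t)).1 by near: u.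
have eq : (toC2 (c u)).2 = cexp ((u - t)%:C * - conjc k) * (toC2 (c t)).2 by near: u.
by rewrite /flow_map conjcM conjc_real -mulrN -eq -ep; case: (toC2 (c u)).
Unshelve. all: by end_near. Qed.

Lemma flow_map_integral_curve (t : R) z (u : R) :
  exists2 v, is_derive u (1 : R) (fun s => ofC2 (flow_map ((s - t)%:C * k) z)) v &
    hamiltonian_vector f (ofC2 (flow_map ((u - t)%:C * k) z)) v.
Proof.
set w := flow_map ((u - t)%:C * k) z.
exists (ofC2 (k * w.1, - conjc k * w.2)); last by apply/ham; rewrite !ofC2K.
apply/is_derive_toC2; rewrite ofC2K.
have -> : (fun s => (toC2 (ofC2 (flow_map ((s - t)%:C * k) z))).1) =
          (fun s => cexp ((s - t)%:C * k) * z.1).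
  by apply/funext => s; rewrite ofC2K.
have -> : (fun s => (toC2 (ofC2 (flow_map ((s - t)%:C * k) z))).2) =
          (fun s => cexp ((s - t)%:C * - conjc k) * z.2).
  by apply/funext => s; rewrite ofC2K /flow_map /= conjcM conjc_real mulrN.
split.
- have := cderiv_cexp t k (cderiv_cst z.1 u).
  by rewrite addr0 mulrCA.
- have := cderiv_cexp t (- conjc k) (cderiv_cst z.2 u).
  by rewrite addr0 mulrCA /w /flow_map /= conjcM conjc_real -mulrN.
Qed.

(** The curve may cross from one chart to the other infinitely often. In each chart it
    follows the linear flow, which acts on multipliers by multiplication with
    [e^((u - t) k)]; hence the conclusion at [u] is equivalent to the conclusion
    at any nearby [t]. *)
Lemma flow_fiber_point_unique b a gam : b != 0 -> integral_curve S eps del f gam ->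
  gam 0 = fiber_point b a -> forall t, gam t = fiber_point b (cexp (t%:C * k) * a).
Proof.
move=> b0 ic g0.
apply: locally_constant_prop; last by rewrite mul0r cexp0 mul1r.
move=> t; have [U [c [UC H]]] := ic t.
have H3 : \forall u \near t, exists2 v, is_derive u (1 : R) c v & hamiltonian_vector f (c u) v.
  by apply: filterS H => u [].
have HP := integral_curve_flow_map H3.
have [Ut gt _] := nbhs_singleton H.
near=> u.
have [Uu gu _] : [/\ U (toC2 (c u)), gam u = cls (toC2 (c u)) &
  exists2 v, is_derive u (1 : R) c v & hamiltonian_vector f (c u) v] by near: u.
have cu : toC2 (c u) = flow_map ((u - t)%:C * k) (toC2 (c t)) by near: u.
have Xt := charts_X' UC Ut; have Xu := charts_X' UC Uu.
rewrite gu gt (cls_fiber_point _ _ Xu) (cls_fiber_point _ _ Xt) cu Hmod_flow_map.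
have uE : cexp (u%:C * k) = cexp ((u - t)%:C * k) * cexp (t%:C * k).
  by rewrite -cexpD -mulrDl -rmorphD /= subrK.
have e0 := cexp_neq0 ((u - t)%:C * k).
split=> -[Hb E]; (split; first exact: Hb); move: E; rewrite multiplier_flow_map ?Hb// uE -mulrA.
  move=> [n E]; exists n; apply: (mulfI e0); rewrite E; ring.
move=> [n E]; exists n; rewrite E; ring.
Unshelve. all: by end_near. Qed.

Lemma flow_fiber_point_exists b a : normc b < eps -> b != 0 -> a != 0 ->
  integral_curve S eps del f (fun t => fiber_point b (cexp (t%:C * k) * a)).
Proof.
move=> be b0 a0 t.
have e0 : cexp (t%:C * k) * a != 0 by rewrite mulf_neq0 ?cexp_neq0.
have [d [Fd db da dE]] := fiber_point_rep be b0 e0.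
have [U UC Ud] := fundom_chart Fd.
(* Near [t] the curve is the linear flow in a chart around [d]; it may leave
   the chart later, when another representative takes over. *)
pose c := fun u : R => ofC2 (flow_map ((u - t)%:C * k) d).
exists U, c; split; first exact: UC.
have cc : {for t, continuous c}.
  have [v dv _] := flow_map_integral_curve t d t.
  by apply/differentiable_continuous/derivable1_diffP; case: dv.
have ct : c t = ofC2 d.
  rewrite /c subrr mul0r /flow_map conjc0 oppr0 cexp0 !mul1r.
  by case: (d).
have nU : \forall u \near t, U (toC2 (c u)).
  apply: (cc [set z | U (toC2 z)]); rewrite ct.
  by apply: open_nbhs_nbhs; split; [exact: chart_open|rewrite /= ofC2K].
apply: filterS nU => u Uu; split; first exact: Uu.
  apply/esym/(cls_fiber_point _ _ (charts_X' UC Uu)); rewrite ofC2K Hmod_flow_map.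
  split; first exact: db.
  rewrite multiplier_flow_map ?db//.
  have -> : cexp (u%:C * k) = cexp ((u - t)%:C * k) * cexp (t%:C * k).
    by rewrite -cexpD -mulrDl -rmorphD /= subrK.
  by rewrite -mulrA; apply: eq_mod_period_mul da; exact: eq_mod_period_refl.
exact: flow_map_integral_curve.
Qed.

Lemma flow_fiber_point b a (t : R) y : normc b < eps -> b != 0 -> a != 0 ->
  flow S eps del f t (fiber_point b a) y <-> y = fiber_point b (cexp (t%:C * k) * a).
Proof.
move=> be b0 a0; split=> [[gam [ic g0 <-]]|->].
  exact: flow_fiber_point_unique.
exists (fun t => fiber_point b (cexp (t%:C * k) * a)); split.
- exact: flow_fiber_point_exists.
- by rewrite mul0r cexp0 mul1r.
- by [].
Qed.

End Flow.

(** * Smoothness of the addition *)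

Section Smoothness.
Variable r : R.
Hypotheses (S_smooth : smooth_on (disc r) S) (eps_r : eps <= r).
Notation R4 := ((R * R) * (R * R))%type.

(** [S1] and [S2] are values of the differential of [S] at fixed vectors, hence
    smooth. *)
Lemma cCk_twist (V : normedModType R) (W : set V) (n : nat) (h : V -> C) :
  open W -> (forall x, W x -> normc (h x) < eps) -> cCk W n h ->
  cCk W n (fun x => twist (h x)).
Proof.
move=> oW hW [hr hi].
have hd x : W x -> disc r (complex.Re (h x), complex.Im (h x)).
  by move=> /hW hx; apply: disc_normc; exact: lt_le_trans hx eps_r.
split.
- exact: (Ck_comp2 oW (@open_disc _ r) hd hr hi (Ck_derive n (1, 0) S_smooth)).
- exact: (Ck_comp2 oW (@open_disc _ r) hd hr hi (Ck_derive n (0, 1) S_smooth)).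
Qed.

Lemma open_X (V : normedModType R) (W : set V) (g : V -> R4) : open W ->
  Ck 0 W g -> open [set x | W x /\ X (toC2 (g x))].
Proof.
move=> oW Cg; rewrite openE => x [Wx Xx].
have [cp cq] := cCk_toC2 oW Cg.
have nX := near_ltr (continuous_normc oW (cCk_mul oW cp cq) Wx) (@cst_continuous _ _ eps x) Xx.
by apply: filterS2 (open_nbhs_nbhs (conj oW Wx)) nX => y Wy Xy; split.
Qed.

Lemma chart_open U : charts S eps del U -> open [set z : R4 | U (toC2 z)].
Proof.
have Cid n (W : set R4) : Ck n W (fun z : R4 => z) by exact: Ck_id.
pose W := [set z : R4 | setT z /\ X (toC2 z)].
have oW : open W by apply: open_X openT _.
have [cp cq] := cCk_toC2 oW (Cid 0 W).
have cs : cCk W 0 (fun z : R4 => twist (Hmod (toC2 z))).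
  apply: cCk_twist => //; last by apply: cCk_Hmod => //; exact: Cid.
  by move=> z [_ /X_Hmod].
have ce (s : R) (z : R4) : W z ->
    {for z, continuous (fun z : R4 => expR (S1 (Hmod (toC2 z)) + s))}.
  by apply: (Ck_expR oW (Ck_add oW cs.1 (Ck_cst W 0 s))).
have cn1 (z : R4) : W z -> {for z, continuous (fun z : R4 => normc (toC2 z).1)}.
  exact: continuous_normc.
have cn2 (z : R4) : W z -> {for z, continuous (fun z : R4 => normc (toC2 z).2)}.
  exact: continuous_normc.
move=> UC; rewrite openE => z Uz.
have Wz : W z by split => //; have [] := charts_X' UC Uz.
have nW := open_nbhs_nbhs (conj oW Wz).
case: UC => UE; rewrite UE in Uz *; case: Uz => _ h1 h2.
- have n1 := near_ltr (cn2 z Wz) (@cst_continuous _ _ (1 : R) z) h1.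
  have h2' : normc (toC2 z).1 < expR (S1 (Hmod (toC2 z)) + 0) by rewrite addr0.
  have n2 := near_ltr (cn1 z Wz) (ce 0 z Wz) h2'.
  apply: filterS3 nW n1 n2 => y [_ Xy] y1 y2; split; [exact: Xy|exact: y1|].
  by rewrite addr0 in y2.
- have n1 := near_ltr (ce (- del) z Wz) (cn1 z Wz) h1.
  have n2 := near_ltr (cn1 z Wz) (ce del z Wz) h2.
  by apply: filterS3 nW n1 n2 => y [_ Xy] y1 y2; split; [exact: Xy|exact: y1|exact: y2].
Qed.

Lemma joint_flow_fiber_point b a (t : R * R) y : normc b < eps -> b != 0 -> a != 0 ->
  joint_flow S eps del t (fiber_point b a) y <-> y = fiber_point b (cexp (t.1 +i* t.2) * a).
Proof.
move=> be b0 a0; rewrite /joint_flow.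
have f1 a' := @flow_fiber_point H1 1 (@hamiltonian_H1 R) chart_open b a'.
have f2 a' := @flow_fiber_point H2 (0 +i* 1) (@hamiltonian_H2 R) chart_open b a'.
have a20 : cexp (t.2%:C * (0 +i* 1)) * a != 0 by rewrite mulf_neq0 ?cexp_neq0.
have tE : cexp (t.1 +i* t.2) * a = cexp (t.1%:C * 1) * (cexp (t.2%:C * (0 +i* 1)) * a).
  rewrite mulrA -cexpD; congr (cexp _ * _).
  by rewrite mulr1; apply: complex_ext => /=; ring.
rewrite tE; split=> [[w /f2 -> // /f1 -> //]|->].
by exists (fiber_point b (cexp (t.2%:C * (0 +i* 1)) * a)); [exact/f2|exact/f1].
Qed.

Lemma fiber_sum_fiber_add (x y z : set (C * C)) :
  fiber_product S eps del (x, y) -> HS x != 0 ->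
  fiber_sum S eps del (HS x) x y z <-> z = fiber_add x y.
Proof.
move=> [/= Xx Xy xy] b0.
have [a [a0 be xE]] := fiber_pointP Xx b0.
have [|a' [a0' _ yE]] := fiber_pointP Xy; first by rewrite -xy.
rewrite -xy in yE; move: (HS x) b0 be xE yE => b b0 be -> ->.
have J t (w : set (C * C)) := @joint_flow_fiber_point b 1 t w be b0 (oner_neq0 _).
have addE (t t' : R * R) : cexp ((t + t').1 +i* (t + t').2) =
    cexp (t.1 +i* t.2) * cexp (t'.1 +i* t'.2).
  by rewrite -cexpD.
rewrite /fiber_sum (sigmaS_fiber_point be b0); split.
  move=> [t [t' []]] /J -> /J -> /J ->.
  by rewrite !mulr1 addE fiber_add_point// cexp_neq0.
move=> ->; have [u [uE _ _]] := polar a0; have [u' [uE' _ _]] := polar a0'.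
exists (complex.Re u, complex.Im u), (complex.Re u', complex.Im u').
have ue (v : C) : (complex.Re v, complex.Im v).1 +i* (complex.Re v, complex.Im v).2 = v.
  by case: v.
split; apply/J; rewrite ?addE !ue ?uE ?uE' !mulr1 ?fiber_add_point//.
Qed.

(** The maps [g] and [g'] will be the two projections of [R4 * R4], in either order. *)
Section SumSmooth.
Variables (V : normedModType R) (g g' : V -> R4).
Hypotheses (Cg : forall n (W : set V), open W -> Ck n W g)
           (Cg' : forall n (W : set V), open W -> Ck n W g').

Let dom_X := [set x | setT x /\ X (toC2 (g x))].

Let open_dom_X : open dom_X.
Proof. by apply: open_X openT _; apply: Cg; exact: openT. Qed.

Definition dom_q := [set x | dom_X x /\ (toC2 (g' x)).2 != 0].
Definition dom_p := [set x | dom_X x /\ (toC2 (g x)).1 != 0].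

Lemma open_neq0 (h : V -> C) : cCk dom_X 0 h -> open [set x | dom_X x /\ h x != 0].
Proof.
move=> Ch; rewrite openE => x [Nx]; rewrite -normc_gt0 => hx.
have nh := near_ltr (@cst_continuous _ _ 0 x) (continuous_normc open_dom_X Ch Nx) hx.
by apply: filterS2 (open_nbhs_nbhs (conj open_dom_X Nx)) nh => y Ny; rewrite normc_gt0.
Qed.

Lemma open_dom_q : open dom_q.
Proof. by apply: open_neq0; have [] := cCk_toC2 open_dom_X (Cg' 0 open_dom_X). Qed.

Lemma open_dom_p : open dom_p.
Proof. by apply: open_neq0; have [] := cCk_toC2 open_dom_X (Cg 0 open_dom_X). Qed.

Lemma smooth_add_q : smooth_on dom_q (fun x => ofC2 (add_q (toC2 (g x)) (toC2 (g' x)))).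
Proof.
move=> n; have oN := open_dom_q.
have [p q] := cCk_toC2 oN (Cg n oN); have [p' q'] := cCk_toC2 oN (Cg' n oN).
apply: (Ck_ofC2 oN); last exact: cCk_mul.
apply: (cCk_mul oN p); apply: cCk_inv => //; last exact: cCk_conj.
by move=> x [_ h]; rewrite conjc_eq0.
Qed.

Lemma smooth_add_p : smooth_on dom_p (fun x => ofC2 (add_p (toC2 (g x)) (toC2 (g' x)))).
Proof.
move=> n; have oN := open_dom_p.
have [p q] := cCk_toC2 oN (Cg n oN); have [p' q'] := cCk_toC2 oN (Cg' n oN).
have tw : cCk dom_p n (fun x => twist (Hmod (toC2 (g x)))).
  apply: cCk_twist => //; last by apply: cCk_Hmod => //; exact: Cg.
  by move=> x [[_ /X_Hmod]].
apply: (Ck_ofC2 oN).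
  apply: (cCk_mul oN (cCk_mul oN p p')); apply: cCk_inv => //; last exact: cCk_cexp.
  by move=> x _; exact: cexp_neq0.
apply: (cCk_mul oN).
  by apply: (cCk_mul oN q'); apply: cCk_cexp => //; exact: cCk_conj.
apply: cCk_inv => //; last exact: cCk_conj.
by move=> x [_ h]; rewrite conjc_eq0.
Qed.

End SumSmooth.

(** It suffices to find, near each pair of points of the fundamental domain, one smooth
    formula for the sum whose value at this pair is in the fundamental domain: by
    continuity its values stay in a chart around that value, and there they represent
    the sum because [fiber_add] is independent of representatives. *)
Lemma smooth_at_of_formula (d d' : C * C) (N : set (R4 * R4)) (F : R4 * R4 -> R4) :
  fundom d -> fundom d' -> open N -> N (ofC2 d, ofC2 d') -> smooth_on N F ->
  fundom (toC2 (F (ofC2 d, ofC2 d'))) ->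
  (forall w w' : R4, N (w, w') -> Hmod (toC2 w) = Hmod (toC2 w') ->
    is_sum (toC2 w) (toC2 w') (toC2 (F (w, w')))) ->
  exists (U U' U'' : set (C * C)) (z z' : R4) (N : set (R4 * R4)) (F : R4 * R4 -> R4),
  [/\ charts S eps del U, charts S eps del U' & charts S eps del U''] /\
  [/\ U (toC2 z), U' (toC2 z'), cls d = cls (toC2 z) & cls d' = cls (toC2 z')] /\
  [/\ open N, N (z, z'), smooth_on N F &
      forall w w' : R4, N (w, w') -> U (toC2 w) -> U' (toC2 w') ->
        punctured_fiber_product S eps del (cls (toC2 w), cls (toC2 w')) ->
        U'' (toC2 (F (w, w'))) /\
        fiber_add (cls (toC2 w)) (cls (toC2 w')) = cls (toC2 (F (w, w')))].
Proof.
move=> Fd Fd' oN Nd sF Fw sumF.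
have [U UC Ud] := fundom_chart Fd; have [U' UC' Ud'] := fundom_chart Fd'.
have [U'' UC'' Uw] := fundom_chart Fw.
exists U, U', U'', (ofC2 d), (ofC2 d').
exists (N `&` F @^-1` [set z | U'' (toC2 z)]), F.
rewrite !ofC2K; split; first by split.
split; first by split.
split.
- rewrite openE => x [Nx Ux].
  have cF := sF 0 x Nx.
  have nU := cF _ (open_nbhs_nbhs (conj (chart_open UC'') Ux)).
  by apply: filterS2 (open_nbhs_nbhs (conj oN Nx)) nU => y Ny Uy; split.
- by split.
- by move=> n; apply: Ck_subset (sF n) => x [].
- move=> w w' [Nw Uw''] Uw0 Uw0' [[/= _ _ Hww'] _]; split; first exact: Uw''.
  have Xw := charts_X' UC Uw0; have Xw' := charts_X' UC' Uw0'.
  have Xs := charts_X' UC'' Uw''.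
  by apply: fiber_add_cls => //; apply: sumF => //; rewrite -(HS_cls Xw) -(HS_cls Xw').
Qed.

Lemma smooth_fiber_add : smooth_on_punctured_fiber_product S eps del fiber_add.
Proof.
move=> x y /punctured_fundom[d [d' [[Fd ->] [Fd' ->] H n0]]].
have C1 n (W : set (R4 * R4)) : open W -> Ck n W (fun v : R4 * R4 => v.1).
  by move=> oW; apply: (Ck_lincomp oW (@continuous_fst _ _ _)); exact: Ck_id.
have C2 n (W : set (R4 * R4)) : open W -> Ck n W (fun v : R4 * R4 => v.2).
  by move=> oW; apply: (Ck_lincomp oW (@continuous_snd _ _ _)); exact: Ck_id.
have [Xd _ _] := Fd; have [Xd' _ _] := Fd'.
case: (fundom_sum_formula Fd Fd' H n0) => -[nz Fs].
- apply: (smooth_at_of_formula Fd Fd' (open_dom_q C1 C2) _ (smooth_add_q C1 C2)).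
  + rewrite -(ofC2K d') in nz.
    by split; [split; [exact: I|rewrite /= ofC2K; assumption]|exact: nz].
  + by rewrite /= !ofC2K.
  + by move=> w w' [_ h] hH; rewrite ofC2K; exact: add_qP.
- apply: (smooth_at_of_formula Fd Fd' (open_dom_p C1) _ (smooth_add_p C1 C2)).
  + rewrite -(ofC2K d) in nz.
    by split; [split; [exact: I|rewrite /= ofC2K; assumption]|exact: nz].
  + by rewrite /= !ofC2K.
  + by move=> w w' [_ h] hH; rewrite ofC2K; exact: add_pP.
- apply: (smooth_at_of_formula Fd Fd' (open_dom_q C2 C1) _ (smooth_add_q C2 C1)).
  + rewrite -(ofC2K d) in nz.
    by split; [split; [exact: I|rewrite /= ofC2K; assumption]|exact: nz].
  + by rewrite /= !ofC2K.
  + by move=> w w' [_ h] hH; rewrite ofC2K; apply: is_sumC; apply: add_qP.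
- apply: (smooth_at_of_formula Fd Fd' (open_dom_p C2) _ (smooth_add_p C2 C1)).
  + rewrite -(ofC2K d') in nz.
    by split; [split; [exact: I|rewrite /= ofC2K; assumption]|exact: nz].
  + by rewrite /= !ofC2K.
  + by move=> w w' [_ h] hH; rewrite ofC2K; apply: is_sumC; apply: add_pP.
Qed.

End Smoothness.

End Model.

(** Continuity of [S1] at the origin gives the smallness condition on a disc, for all
    [del <= 1]. *)
Lemma small_disc (R : realType) (S : R * R -> R) (r : R) : 0 < r ->
  smooth_on (disc r) S ->
  exists2 e : R, 0 < e <= r &
    forall b : R[i], normc b < e -> normc b * expR 1 < expR (S1 S b).
Proof.
move=> r0 S_smooth.
have C1 := Ck_derive 0 (1, 0) S_smooth.
have d0 : disc r (0, 0) by rewrite /disc /= !expr0n addr0 exprn_gt0.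
have c0 := Ck_continuous C1 d0.
set s0 := 'D_(1, 0) S (0, 0).
have s1 : s0 - 1 < s0 by rewrite ltrBlDr ltrDl.
have := near_ltr (@cst_continuous _ _ (s0 - 1) (0, 0)) c0 s1.
move=> /nbhs_ballP[e1 e1_gt0 He1].
(* One unit of the exponent is the variation of [S1] on the disc, the other
   absorbs the factor [expR 1]. *)
exists (Num.min r (Num.min e1 (expR (s0 - 2)))).
  by rewrite ge_min lexx !lt_min r0 e1_gt0 expR_gt0.
move=> b; rewrite !lt_min => /and3P[_ be1 be].
have : s0 - 1 < S1 S b.
  apply: He1; split => /=.
    rewrite /ball /= sub0r normrN; apply: le_lt_trans be1.
    by case: (b) => x y /=; rewrite -sqrtr_sqr ler_wsqrtr// lerDl sqr_ge0.
  rewrite /ball /= sub0r normrN; apply: le_lt_trans be1.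
  by case: (b) => x y /=; rewrite -sqrtr_sqr ler_wsqrtr// lerDr sqr_ge0.
rewrite -ltr_expR; apply: le_lt_trans.
have -> : s0 - 1 = s0 - 2 + 1 by ring.
by rewrite expRD ler_wpM2r ?expR_ge0// ltW.
Qed.

Theorem proposition2p7 (R : realType) (S : R * R -> R) (r : R)
    (r_gt0 : 0 < r) (S_smooth : smooth_on (disc r) S) :
  exists eps0 del0 : R, 0 < eps0 /\ 0 < del0 /\
  forall eps del : R, 0 < eps < eps0 -> 0 < del < del0 ->
  exists A : set (R[i] * R[i]) -> set (R[i] * R[i]) -> set (R[i] * R[i]),
  [/\ forall x y, punctured_fiber_product S eps del (x, y) ->
        XS S eps del (A x y) /\ HS (A x y) = HS x,
      smooth_on_punctured_fiber_product S eps del A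
    & forall x y z, fiber_product S eps del (x, y) -> HS x != 0 ->
        fiber_sum S eps del (HS x) x y z <-> z = A x y].
Proof.
have [e0 /andP[e0_gt0 e0r] small] := small_disc r_gt0 S_smooth.
exists e0, 1; split; first exact: e0_gt0.
split; first exact: ltr01.
move=> eps del /andP[eps_gt0 eps_lt] /andP[del_gt0 del_lt].
have small' b : normc b < eps -> normc b * expR del < expR (S1 S b).
  move=> be; apply: le_lt_trans (small b (lt_trans be eps_lt)).
  by rewrite ler_wpM2l ?normc_ge0// ler_expR ltW.
have eps_r : eps <= r by apply: ltW; exact: lt_le_trans eps_lt e0r.
exists (fiber_add S eps del); split.
- by move=> x y; exact: fiber_add_XS.
- exact: (smooth_fiber_add del_gt0 small' S_smooth eps_r).
- by move=> x y z; exact: (fiber_sum_fiber_add del_gt0 small' S_smooth eps_r).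
Qed.
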